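(* There is a polynomial-time randomized algorithm which, given as input an instance $(\vec a,t)$ of \textsc{Subset Sum} with $n$ elements, outputs a collection of $O(n^3)$ instances $(\vec a',t')$ of \textsc{Subset Sum}, each with $n$ elements and with $\log t'=O(n)$, such that: if $(\vec a,t)$ has no solution then, with probability $1-o(1)$, none of the output instances has a solution; and if $(\vec a,t)$ has a solution then, with probability $\Omega(1)$, at least one of the output instances has at least one and at most $O(1)$ solutions.
   Context: An instance $(\vec a,t)$ of \textsc{Subset Sum} consists of a vector $\vec a\in\mathbb{Z}_{\ge 0}^n$ and a target $t\in\mathbb{Z}_{\ge 0}$; a solution of $(\vec a,t)$ is a vector $\vec x\in\{0,1\}^n$ with $\sum_{i=1}^n a_ix_i=t$ (equality over the integers). *)

(* Defs.v *)
From HB Require Import structures.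
From mathcomp Require Import all_boot all_order all_algebra.

Set Implicit Arguments.
Unset Strict Implicit.
Unset Printing Implicit Defensive.

Import Order.TTheory GRing.Theory Num.Theory.

(* The number of elements is [size (weights I)]; keeping it out of the type
   lets an algorithm map instances of any size to instances of any size. *)
Record instance := Instance { weights : seq nat; target : nat }.

Definition nelem (I : instance) : nat := size (weights I).

Definition is_solution (I : instance) (x : (nelem I).-tuple bool) : bool :=
  \sum_(i < nelem I) nth 0 (weights I) i * tnth x i == target I.

Definition nsol (I : instance) : nat := #|[set x | @is_solution I x]|.

Definition solvable (I : instance) : bool := [exists x, @is_solution I x].

(* Model of computation: the random access machine with read-only input tape,
   write-only output tape and the operations +, -, *, / (Aho, Hopcroft, Ullman),
   with structured control instead of jumps and an extra coin-flip instruction.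
   Time is measured by the logarithmic cost criterion, for which polynomial time
   coincides with polynomial time on Turing machines.  Registers hold natural
   numbers, [Monus] is truncated, and division by 0 yields 0. *)

(* Length of the binary representation; [blen 0 = 1]. *)
Definition blen (k : nat) : nat := (trunc_log 2 k).+1.

Inductive expr :=
  | Const of nat
  | Deref of expr
  | Add of expr & expr
  | Monus of expr & expr
  | Mul of expr & expr
  | Div of expr & expr.

Fixpoint eval (M : nat -> nat) (e : expr) : nat :=
  match e with
  | Const k => k
  | Deref e1 => M (eval M e1)
  | Add e1 e2 => eval M e1 + eval M e2
  | Monus e1 e2 => eval M e1 - eval M e2
  | Mul e1 e2 => eval M e1 * eval M e2
  | Div e1 e2 => eval M e1 %/ eval M e2
  end.

(* Every value that occurs, be it an operand, an address, the content of a
   register or a result, is charged its binary length. *)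
Fixpoint ecost (M : nat -> nat) (e : expr) : nat :=
  blen (eval M e) +
  match e with
  | Const _ => 0
  | Deref e1 => ecost M e1
  | Add e1 e2 | Monus e1 e2 | Mul e1 e2 | Div e1 e2 => ecost M e1 + ecost M e2
  end.

Inductive cmd :=
  | Skip
  | Store of expr & expr
  | Read of expr
  | Write of expr
  | Flip of expr
  | Seq of cmd & cmd
  | If of expr & cmd & cmd
  | While of expr & cmd.

Record state := State {
  mem : nat -> nat;
  inp : seq nat;
  coins : seq bool;
  out : seq nat
}.

Definition upd (M : nat -> nat) (a v : nat) : nat -> nat :=
  fun i => if i == a then v else M i.

(* [exec c s s' k]: started in [s], the command [c] halts in [s'] at cost [k].
   The first argument of [Store], [Read] and [Flip] is the address written to;
   a test succeeds when it is nonzero.  The relation is deterministic; reading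
   past the end of the input, or flipping with no coin left, has no rule. *)
Inductive exec : cmd -> state -> state -> nat -> Prop :=
  | ExecSkip s : exec Skip s s 1
  | ExecStore e f M i w o :
      exec (Store e f) (State M i w o)
        (State (upd M (eval M e) (eval M f)) i w o) (ecost M e + ecost M f)
  | ExecRead e M v i w o :
      exec (Read e) (State M (v :: i) w o)
        (State (upd M (eval M e) v) i w o) (ecost M e + blen v)
  | ExecWrite e M i w o :
      exec (Write e) (State M i w o)
        (State M i w (rcons o (eval M e))) (ecost M e)
  | ExecFlip e M i b w o :
      exec (Flip e) (State M i (b :: w) o)
        (State (upd M (eval M e) b) i w o) (ecost M e + 1)
  | ExecSeq c1 c2 s1 s2 s3 k1 k2 :
      exec c1 s1 s2 k1 -> exec c2 s2 s3 k2 ->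
      exec (Seq c1 c2) s1 s3 (k1 + k2)
  | ExecIfTrue e c1 c2 s s' k :
      eval (mem s) e != 0 -> exec c1 s s' k ->
      exec (If e c1 c2) s s' (ecost (mem s) e + k)
  | ExecIfFalse e c1 c2 s s' k :
      eval (mem s) e = 0 -> exec c2 s s' k ->
      exec (If e c1 c2) s s' (ecost (mem s) e + k)
  | ExecWhileTrue e c s1 s2 s3 k1 k2 :
      eval (mem s1) e != 0 -> exec c s1 s2 k1 -> exec (While e c) s2 s3 k2 ->
      exec (While e c) s1 s3 (ecost (mem s1) e + k1 + k2)
  | ExecWhileFalse e c s :
      eval (mem s) e = 0 -> exec (While e c) s s (ecost (mem s) e).

Definition encode (I : instance) : seq nat := nelem I :: target I :: weights I.

Definition encode_list (l : seq instance) : seq nat :=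
  size l :: flatten (map encode l).

Definition isize (I : instance) : nat := \sum_(k <- encode I) blen k.

Definition init (I : instance) (r : seq bool) : state :=
  State (fun=> 0) (encode I) r [::].

(* [A I r] is the output on input [I] when the coin flips come out as [r].
   A single program computes it on every input, within time [p.[isize I]] for
   every outcome of the coins; as each flip costs at least 1, a supply of
   [p.[isize I]] coins is never exhausted. *)
Definition rand_polytime (p : {poly nat})
    (A : instance -> seq bool -> seq instance) : Prop :=
  exists c : cmd, forall (I : instance) (r : seq bool),
    size r = (p.[isize I])%R ->
    exists s k, [/\ exec c (init I r) s k, out s = encode_list (A I r)
                  & k <= (p.[isize I])%R].

(* Probability of [E] under [m] independent fair coin flips. *)
Definition prob (m : nat) (E : pred (seq bool)) : rat :=
  (#|[set r : m.-tuple bool | E r]|%:R / 2%:R ^+ m)%R.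

(* Main.v *)
(* Write V for the sum of all weights and the target; its number of bits is
   below a power of two G = 2^beta (up to a factor 2, the bit length of V).

   If 2^(n+1) <= G, the input is exponentially long and trying all subsets
   takes polynomial time.

   Otherwise, let P be a product of s ~ 2n / beta primes, drawn uniformly from
   a table of N = 2 G^2 primes below N^2 (Chebyshev: there are that many).  A
   nonzero a.x - t has at most G prime divisors, hence is divisible by P with
   probability at most (G / N)^s <= 2^-(2n+4); by a union bound, with
   probability 1 - 2^-(n+4) the equation mod P has no spurious solution.  Since
   beta <= n, P is still 2^O(n).

   For isolation, each coefficient a_i mod P is lifted to a random
   c_i = (a_i mod P) + P r_i and the target likewise.  Modulo P 2^j, a solution
   x of the original instance survives iff alpha_x + r.x = r_0 mod 2^j; these
   events are pairwise independent of probability 2^-j, so for the right j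
   exactly one solution survives with constant probability (Valiant-Vazirani).
   The congruence mod Q = P 2^j becomes n integer equations by guessing the
   carry k < n. *)

Require Import Defs.
From HB Require Import structures.
From mathcomp Require Import all_boot all_order all_algebra.
From mathcomp Require Import zify ring.
From Stdlib Require Import FunctionalExtensionality.

Set Implicit Arguments.
Unset Strict Implicit.
Unset Printing Implicit Defensive.

Import Order.TTheory GRing.Theory Num.Theory.

(** * The cost of random access machine programs *)

(** A single random prime with [O(n)] bits would require a primality test. Primes of size polynomial
    in the input can instead be tabulated naively, which is affordable because [G] is at most twice
    the input length. Sampling with fair coins must be exact, so [G], [N] and the range of a field
    are powers of two: a uniform field is then exactly uniform modulo [N] and modulo every [2 ^ j]
    in use. Isolation cannot be imposed as a second equation, since each output is one equation on
    the same [n] elements. Multiplying the random multipliers by [P] packs both conditions into one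
    congruence. The term [alpha_x] is uncontrolled, but it depends on the choice of [P] only and is
    therefore independent of the multipliers. The right [j] depends on the unknown number of
    solutions, so [n + 3] values are tried. Wrong guesses of [j] or of the carry are harmless: a
    solution of any output instance still satisfies the original equation modulo [P], so an
    unsolvable input can be spoilt only by a spurious solution. *)

Lemma blen_le k x : 0 < x -> k < 2 ^ x -> blen k <= x.
Proof.
rewrite /blen => x0 kx; case: k kx => [|k] kx; first by rewrite trunc_log0.
by rewrite -(@ltn_exp2l 2) //; apply: leq_ltn_trans kx; apply: trunc_logP.
Qed.

(** Size of the value of an expression in units of [X] bits, when every register fits in [X] bits.
    It depends on the syntax only, so the total cost is [X] times the number of steps times a
    constant of the program. *)
Fixpoint width (e : expr) : nat :=
  match e with
  | Const k => k.+1
  | Deref _ => 1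
  | Add e1 e2 | Mul e1 e2 => width e1 + width e2
  | Monus e1 _ | Div e1 _ => width e1
  end.

Fixpoint weight (e : expr) : nat :=
  width e +
  match e with
  | Const _ => 0
  | Deref e1 => weight e1
  | Add e1 e2 | Monus e1 e2 | Mul e1 e2 | Div e1 e2 => weight e1 + weight e2
  end.

Fixpoint cweight (c : cmd) : nat :=
  match c with
  | Skip => 1
  | Store e f => weight e + weight f
  | Read e | Write e | Flip e => weight e + 1
  | Seq c1 c2 => cweight c1 + cweight c2
  | If e c1 c2 => weight e + (cweight c1 + cweight c2)
  | While e c1 => weight e + cweight c1
  end.

Section Runs.

Variables (X : nat) (X_gt0 : 0 < X).

Definition small (M : nat -> nat) := forall a, M a < 2 ^ X.

Lemma width_gt0 e : 0 < width e.
Proof. by elim: e => //= e1 h1 e2 h2; rewrite addn_gt0 h1. Qed.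

Lemma eval_small M e : small M -> eval M e < 2 ^ (X * width e).
Proof.
move=> sM; elim: e => [k|e _|e1 h1 e2 h2|e1 h1 e2 h2|e1 h1 e2 h2|e1 h1 e2 h2] /=.
- apply: leq_trans (_ : 2 ^ k.+1 <= _); first by rewrite ltnW // ltn_expl.
  by rewrite leq_exp2l // leq_pmull.
- by rewrite muln1.
(* Both bounds are at least 2, hence their sum is at most their product. *)
- have := width_gt0 e1; have := width_gt0 e2 => w2 w1.
  have a1 : 0 < X * width e1 by rewrite muln_gt0 X_gt0.
  have a2 : 0 < X * width e2 by rewrite muln_gt0 X_gt0.
  have b1 : 2 <= 2 ^ (X * width e1) by rewrite (leq_exp2l 1).
  have b2 : 2 <= 2 ^ (X * width e2) by rewrite (leq_exp2l 1).
  rewrite mulnDr expnD; nia.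
- exact: leq_ltn_trans (leq_subr _ _) h1.
- by rewrite mulnDr expnD ltn_mul.
- exact: leq_ltn_trans (leq_div _ _) h1.
Qed.

Lemma ecost_small M e : small M -> ecost M e <= X * weight e.
Proof.
move=> sM.
have B f : blen (eval M f) <= X * width f.
  by apply: blen_le; [rewrite muln_gt0 X_gt0 width_gt0 | apply: eval_small].
have S f a b : a <= X * b -> blen (eval M f) + a <= X * (width f + b).
  by move=> ab; rewrite mulnDr leq_add ?B.
have S2 a b c d : a <= X * c -> b <= X * d -> a + b <= X * (c + d).
  by move=> ac bd; rewrite mulnDr leq_add.
by elim: e => [k|e h|e1 h1 e2 h2|e1 h1 e2 h2|e1 h1 e2 h2|e1 h1 e2 h2];
  apply: S => //; apply: S2.
Qed.

(* [u] counts elementary commands and tests; each costs at most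
   [X * cweight c] as long as every register holds less than [2 ^ X]. *)
Definition runs (c : cmd) (s s' : state) (u : nat) : Prop :=
  small (Defs.mem s) ->
  (exists2 k, exec c s s' k & k <= u * (X * cweight c)) /\ small (Defs.mem s').

Lemma runs_weaken c s s' u u' : u <= u' -> runs c s s' u -> runs c s s' u'.
Proof.
move=> uu h sm; have [[k ek kl] sm'] := h sm; split=> //; exists k => //.
by apply: leq_trans kl _; rewrite leq_mul2r uu orbT.
Qed.

Lemma runs_seq c1 c2 s1 s2 s3 u1 u2 :
  runs c1 s1 s2 u1 -> runs c2 s2 s3 u2 -> runs (Seq c1 c2) s1 s3 (u1 + u2).
Proof.
move=> h1 h2 sm; have [[k1 e1 l1] sm2] := h1 sm.
have [[k2 e2 l2] sm3] := h2 sm2; split=> //.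
exists (k1 + k2); first exact: ExecSeq e1 e2.
rewrite /= mulnDl; apply: leq_add.
  by apply: leq_trans l1 _; rewrite !leq_mul // leq_addr.
by apply: leq_trans l2 _; rewrite !leq_mul // leq_addl.
Qed.

Lemma runs_skip s : runs Skip s s 1.
Proof. by move=> sm; split=> //; exists 1; [constructor | rewrite /=; lia]. Qed.

Lemma runs_if_true e c1 c2 s s' u :
  eval (Defs.mem s) e != 0 -> runs c1 s s' u -> runs (If e c1 c2) s s' u.+1.
Proof.
move=> t h sm; have [[k ek kl] sm'] := h sm; split=> //.
exists (ecost (Defs.mem s) e + k); first exact: ExecIfTrue.
have := ecost_small e sm; rewrite /=; nia.
Qed.

Lemma runs_if_false e c1 c2 s s' u :
  eval (Defs.mem s) e = 0 -> runs c2 s s' u -> runs (If e c1 c2) s s' u.+1.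
Proof.
move=> t h sm; have [[k ek kl] sm'] := h sm; split=> //.
exists (ecost (Defs.mem s) e + k); first exact: ExecIfFalse.
have := ecost_small e sm; rewrite /=; nia.
Qed.

(** [S i] is the state after [i] rounds: loops are verified by giving these states explicitly
    instead of an invariant. Each round pays for one test and the body, and the last failing test
    gives the final successor. *)
Lemma runs_while e c (S : nat -> state) N u :
  (forall i, i < N -> eval (Defs.mem (S i)) e != 0) ->
  eval (Defs.mem (S N)) e = 0 ->
  (forall i, i < N -> runs c (S i) (S i.+1) u) ->
  runs (While e c) (S 0) (S N) (N * u.+1).+1.
Proof.
elim: N S => [|N ih] S h1 h2 h3 sm.
  split=> //; exists (ecost (Defs.mem (S 0)) e); first exact: ExecWhileFalse.
  have := ecost_small e sm; rewrite /=; nia.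
have [[k1 e1 l1] sm1] := h3 0 isT sm.
have [[k2 e2 l2] sm2] := ih (fun i => S i.+1) (fun i => h1 i.+1) h2 (fun i => h3 i.+1) sm1.
split=> //; exists (ecost (Defs.mem (S 0)) e + k1 + k2).
  by apply: ExecWhileTrue e1 e2; apply: h1.
have := ecost_small e sm; move: l1 l2; rewrite /=.
move: (weight e) (cweight c) => we wc;
have -> : (N.+1 * u.+1).+1 = u.+1 + (N * u.+1).+1 by rewrite mulSn addnS.
rewrite mulnDl => l1 l2 l3.
apply: leq_add; last exact: l2.
rewrite mulSn; apply: leq_add; first by apply: leq_trans l3 _; rewrite leq_mul2l leq_addr orbT.
by apply: leq_trans l1 _; rewrite !leq_mul // leq_addl.
Qed.

Lemma upd_small M a v : small M -> v < 2 ^ X -> small (upd M a v).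
Proof. by move=> sm lv b; rewrite /upd; case: eqP. Qed.

Lemma runs_store e f M M' i w o :
  eval M f < 2 ^ X -> upd M (eval M e) (eval M f) = M' ->
  runs (Store e f) (State M i w o) (State M' i w o) 1.
Proof.
move=> lv <- sm; split; last exact: upd_small.
exists (ecost M e + ecost M f); first by constructor.
by rewrite mul1n mulnDr leq_add // ecost_small.
Qed.

Lemma runs_read e M M' v i w o :
  v < 2 ^ X -> upd M (eval M e) v = M' ->
  runs (Read e) (State M (v :: i) w o) (State M' i w o) 1.
Proof.
move=> lv <- sm; split; last exact: upd_small.
exists (ecost M e + blen v); first by constructor.
by rewrite mul1n mulnDr leq_add ?ecost_small // muln1 blen_le.
Qed.

Lemma runs_write e M i w o x :
  eval M e = x -> runs (Write e) (State M i w o) (State M i w (rcons o x)) 1.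
Proof.
move=> <- sm; split=> //; exists (ecost M e); first by constructor.
by rewrite mul1n mulnDr (leq_trans (ecost_small e sm)) // leq_addr.
Qed.

Lemma runs_flip e M M' i (b : bool) w o :
  upd M (eval M e) b = M' ->
  runs (Flip e) (State M i (b :: w) o) (State M' i w o) 1.
Proof.
move=> <- sm; split.
  exists (ecost M e + 1); first by constructor.
  by rewrite mul1n mulnDr leq_add ?ecost_small // muln1.
apply: upd_small => //; apply: leq_ltn_trans (leq_b1 b) _.
by rewrite (ltn_exp2l 0).
Qed.

End Runs.

(* Memory layout: 16 scalar registers, then two interleaved arrays [v]
   (even addresses) and [pr] (odd addresses). *)
Definition lay (rg v pr : seq nat) (a : nat) : nat :=
  if a < 16 then nth 0 rg a
  else nth 0 (if odd a then pr else v) (a - 16)./2.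

Lemma lay_v rg v pr i : lay rg v pr (16 + 2 * i) = nth 0 v i.
Proof. by rewrite /lay ltnNge leq_addr /= mul2n oddD odd_double addKn doubleK. Qed.

Lemma lay_v1 rg v pr i : lay rg v pr (18 + 2 * i) = nth 0 v i.+1.
Proof. by rewrite -(lay_v rg v pr); congr lay; lia. Qed.

Lemma lay_pr rg v pr i : lay rg v pr (17 + 2 * i) = nth 0 pr i.
Proof.
rewrite /lay; have -> : (17 + 2 * i < 16) = false by lia.
have -> : 17 + 2 * i - 16 = true + i.*2 by lia.
by rewrite half_bit_double mul2n oddD odd_double.
Qed.

Lemma upd_reg rg v pr c x :
  c < 16 -> upd (lay rg v pr) c x = lay (set_nth 0 rg c x) v pr.
Proof.
move=> c16; apply: functional_extensionality => a; rewrite /upd /lay.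
rewrite nth_set_nth /=; case: eqP => [->|//]; by rewrite c16.
Qed.

Lemma upd_v rg v pr i x :
  upd (lay rg v pr) (16 + 2 * i) x = lay rg (set_nth 0 v i x) pr.
Proof.
apply: functional_extensionality => a; rewrite /upd.
case: eqP => [->|ne]; first by rewrite lay_v nth_set_nth /= eqxx.
rewrite /lay; case: ltnP => // h; case: ifP => // od.
rewrite nth_set_nth /=; case: eqP => // hh; case: ne.
by have := odd_double_half (a - 16); rewrite hh oddB // od /=; lia.
Qed.

Lemma upd_pr rg v pr i x :
  upd (lay rg v pr) (17 + 2 * i) x = lay rg v (set_nth 0 pr i x).
Proof.
apply: functional_extensionality => a; rewrite /upd.
case: eqP => [->|ne]; first by rewrite lay_pr nth_set_nth /= eqxx.
rewrite /lay; case: ltnP => // h; case: ifP => // od.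
rewrite nth_set_nth /=; case: eqP => // hh; case: ne.
by have := odd_double_half (a - 16); rewrite hh oddB // od /=; lia.
Qed.

Lemma set_nth_rcons (s : seq nat) i x : size s = i -> set_nth 0 s i x = rcons s x.
Proof.
by move=> <-; elim: s => [//|y s ih] /=; rewrite ih.
Qed.

(** * Many small primes *)

Definition primes_below (q : nat) : seq nat := [seq p <- iota 2 (q - 2) | prime p].

Lemma divn_double_sub m d : m.*2 %/ d <= (m %/ d).*2 + 1.
Proof.
case: (posnP d) => [->|d0]; first by rewrite !divn0.
rewrite -ltnS ltn_divLR // {1}(divn_eq m d); have := ltn_pmod m d0; nia.
Qed.

Lemma central_bin_fact m : 'C(m.*2, m) * (m`! * m`!) = (m.*2)`!.
Proof. by have := @bin_fact m.*2 m; rewrite -addnn addnK; apply; rewrite leq_addr. Qed.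

(** By Legendre's formula the exponent of [p] is the sum over [k] of [2m %/ p^k - 2 (m %/ p^k)].
    Each term is 0 or 1, and it vanishes once [p ^ k] exceeds [2m]. *)
Lemma logn_central_bin p m : prime p -> 0 < m ->
  p ^ logn p 'C(m.*2, m) <= m.*2.
Proof.
move=> pp m0; have p1 := prime_gt1 pp.
have C0 : 0 < 'C(m.*2, m) by rewrite bin_gt0 -addnn leq_addr.
have := congr1 (logn p) (central_bin_fact m).
rewrite !lognM ?muln_gt0 ?fact_gt0 // !logn_fact // => lg.
suff le : logn p 'C(m.*2, m) <= trunc_log p m.*2.
  by apply: leq_trans (trunc_logP p1 _); rewrite ?leq_exp2l // double_gt0.
have ext : \sum_(1 <= k < m.+1) m %/ p ^ k = \sum_(1 <= k < m.*2.+1) m %/ p ^ k.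
  rewrite [RHS](@big_cat_nat _ _ _ m.+1) //=; last by rewrite ltnS -addnn leq_addr.
  rewrite [X in _ = _ + X]big_nat_cond [X in _ = _ + X]big1 ?addn0 // => k; rewrite andbT => /andP[mk _].
  by rewrite divn_small // (leq_trans mk) // ltnW // ltn_expl.
have tl : trunc_log p m.*2 <= m.*2.
  have := @trunc_logP p m.*2 p1; rewrite double_gt0 => /(_ m0).
  by move=> h; rewrite ltnW // (leq_trans _ h) // ltn_expl.
(* Twice the sum for the factorial of [m] is added to both sides, so that no truncated subtraction
   occurs. *)
rewrite -(leq_add2r (\sum_(1 <= k < m.*2.+1) m %/ p ^ k + \sum_(1 <= k < m.*2.+1) m %/ p ^ k)).
rewrite -ext lg {lg} ext addnn -(muln2 (\sum_(_ <= k < _) _)) big_distrl /=.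
apply: leq_trans (_ : \sum_(1 <= k < m.*2.+1) ((m %/ p ^ k) * 2 + (k <= trunc_log p m.*2)) <= _).
  apply: leq_sum => k _; case: (leqP k) => h.
    by rewrite muln2; apply: divn_double_sub.
  rewrite divn_small //; apply: leq_trans (trunc_log_ltn m.*2 p1) _.
  by rewrite leq_exp2l.
rewrite big_split /= addnC leq_add2r (@big_cat_nat _ _ _ (trunc_log p m.*2).+1) //=.
rewrite [X in _ + X]big_nat_cond [X in _ + X]big1 ?addn0.
  rewrite -{3}[trunc_log p m.*2]subn0 -[_ - 0]/((trunc_log p m.*2).+1 - 1) -[leqRHS]muln1.
  rewrite -sum_nat_const_nat; apply: leq_sum => k _; exact: leq_b1.
by move=> k; rewrite andbT => /andP[h _]; rewrite leqNgt h.
Qed.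

(** Induction on the recurrence [(n+1) C(2n+2, n+1) = 2 (2n+1) C(2n, n)]: one step multiplies the
    right-hand side by [4 (2n+1) / (2n)], which is at least 4. *)
Lemma central_bin_ge m : 0 < m -> 2 ^ m.*2 <= m.*2 * 'C(m.*2, m).
Proof.
elim: m => [//|[|m] ih _]; first by [].
move: {ih} (ih isT); move: m.+1 => n h.
have e : n.+1 * 'C(n.+1.*2, n.+1) = 2 * (n.*2.+1 * 'C(n.*2, n)).
  have f1 := central_bin_fact n.+1; have f2 := central_bin_fact n.
  move: f1; rewrite doubleS !factS -f2 => f1.
  have fp : 0 < n`! * n`! by rewrite muln_gt0 fact_gt0.
  apply/eqP; rewrite -(eqn_pmul2r fp) -(@eqn_pmul2l n.+1) //; apply/eqP.
  have -> : n.+1 * (n.+1 * 'C((n.*2).+2, n.+1) * (n`! * n`!)) =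
    'C((n.*2).+2, n.+1) * (n.+1 * n`! * (n.+1 * n`!)) by ring.
  by rewrite f1 -muln2; ring.
have -> : n.+1.*2 * 'C(n.+1.*2, n.+1) = 4 * (n.*2.+1 * 'C(n.*2, n)).
  by rewrite -{1}mul2n -mulnA e mulnA.
rewrite {1}doubleS !expnS mulnA leq_mul2l /=; apply: leq_trans h _.
by rewrite leq_mul2r leqnSn orbT.
Qed.

Lemma central_bin_primes m : 0 < m ->
  'C(m.*2, m) <= m.*2 ^ size (primes_below m.*2.+1).
Proof.
move=> m0; have C0 : 0 < 'C(m.*2, m) by rewrite bin_gt0 -addnn leq_addr.
have -> : 'C(m.*2, m) = \prod_(p <- primes_below m.*2.+1) p ^ logn p 'C(m.*2, m).
  rewrite {1}(prod_prime_decomp C0) prime_decompE big_map /=.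
  rewrite [RHS](bigID (fun p => p \in primes 'C(m.*2, m))) /= [X in _ * X]big1 ?muln1.
    rewrite -[RHS]big_filter; apply: perm_big; apply: uniq_perm.
    - exact: primes_uniq.
    - by rewrite !filter_uniq // iota_uniq.
    move=> p; rewrite !mem_filter mem_iota; case: (boolP (_ \in _)) => //= h.
    move: h; rewrite mem_primes => /and3P[pp _ pd]; rewrite pp prime_gt1 //=.
    have : p <= m.*2.
      apply: leq_trans (logn_central_bin pp m0).
      by rewrite -{1}(expn1 p) leq_exp2l ?prime_gt1 // -pfactor_dvdn.
    by move: m0; lia.
  move=> p; rewrite mem_primes C0 /= negb_and => /orP[np|nd].
    by rewrite lognE (negPf np).
  by rewrite lognE (negPf nd) !andbF.
have : all prime (primes_below m.*2.+1) by apply: filter_all.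
elim: (primes_below _) => [|p s ih] /=; first by rewrite big_nil.
by move=> /andP[pp ps]; rewrite big_cons expnS leq_mul ?ih // logn_central_bin.
Qed.

(* Chebyshev: [C(2^w, 2^(w-1))] is at least [2^(2^w) / 2^w] and has
   at most [pi(2^w)] prime power factors, each at most [2^w]. *)
Lemma many_primes e : 3 <= e -> 2 ^ e <= size (primes_below (2 ^ (2 * e))).
Proof.
move=> e3; set w := 2 * e; set c := size _.
have w1 : 0 < w by rewrite /w; lia.
pose m := 2 ^ w.-1; have m2 : m.*2 = 2 ^ w by rewrite -mul2n -expnS prednK.
have m0 : 0 < m by rewrite expn_gt0.
(* The binomial bound counts the primes up to [2 ^ w] inclusive and the table those strictly below;
   the counts agree because [2 ^ w] is composite. *)
have np : ~~ prime (2 ^ w).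
  apply/negP => /primeP[_ /(_ 2)]; rewrite dvdn_exp // => /(_ isT) /orP[//|/eqP].
  by move=> h; have := @ltn_exp2l 2 1 w isT; rewrite -h ltnn /w; lia.
have cE : size (primes_below m.*2.+1) = c.
  rewrite /c /primes_below m2; have le2 : 2 <= 2 ^ w by rewrite (leq_exp2l 1).
  rewrite subSn // -[(_ - 2).+1]addn1 iotaD filter_cat /= subnKC // (negPf np).
  by rewrite cats0.
have := leq_trans (central_bin_ge m0) (leq_mul (leqnn _) (central_bin_primes m0)).
rewrite cE -expnS m2 -expnM leq_exp2l // {1}/w => h.
rewrite leqNgt; apply/negP => lt.
have : 2 ^ w <= w * 2 ^ e by apply: leq_trans h _; rewrite leq_mul2l lt orbT.
rewrite /w mul2n -addnn expnD leq_mul2r expn_eq0 /= addnn -mul2n.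
(* Fewer than [2 ^ e] primes would force [2 ^ e <= 2 * e], which fails from [e = 3] on. *)
have {lt h} : forall k, 2 * (3 + k) < 2 ^ (3 + k).
  by elim=> // k ih; rewrite addnS expnS; lia.
by move=> /(_ (e - 3)); rewrite subnKC // ltnNge => /negPf ->.
Qed.

(** * Independent uniform fields of the coin sequence *)

Definition field (H R i : nat) : nat := R %/ H ^ i %% H.

Definition bits_val (r : seq bool) : nat := foldl (fun R (b : bool) => 2 * R + b) 0 r.

Lemma bits_val_rcons r b : bits_val (rcons r b) = 2 * bits_val r + b.
Proof. by rewrite /bits_val foldl_rcons. Qed.

Lemma bits_val_lt r : bits_val r < 2 ^ size r.
Proof.
elim/last_ind: r => [//|r b ih]; rewrite bits_val_rcons size_rcons expnS.
by case: b; lia.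
Qed.

Lemma bits_val_inj r r' : size r = size r' -> bits_val r = bits_val r' -> r = r'.
Proof.
elim/last_ind: r r' => [|r b ih] r'; first by case: r'.
case/lastP: r' => [|r' b']; first by rewrite size_rcons.
rewrite !size_rcons !bits_val_rcons => -[/ih h] e.
have eb : b = b' by case: b b' e => -[] //=; lia.
by rewrite eb h //; move: e; rewrite eb; lia.
Qed.

Lemma field_inj H K R R' : R < H ^ K -> R' < H ^ K ->
  (forall i, i < K -> field H R i = field H R' i) -> R = R'.
Proof.
elim: K R R' => [|K ih] R R'; first by rewrite expn0; case: R R' => [|?] [|?].
case: (posnP H) => [->|H0]; first by rewrite exp0n.
rewrite expnSr -!ltn_divLR // => lR lR' e.
have e0 := e 0 isT; move: e0; rewrite /field expn0 !divn1 => e0.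
rewrite (divn_eq R H) (divn_eq R' H) e0 (ih (R %/ H) (R' %/ H)) // => i iK.
by have := e i.+1 iK; rewrite /field expnS !divnMA.
Qed.

Section Functions.

Variables (K H : nat).

Implicit Types w : {ffun 'I_K -> 'I_H}.

Definition setf w (i : 'I_K) (v : 'I_H) : {ffun 'I_K -> 'I_H} :=
  [ffun k => if k == i then v else w k].

(** Extension by 0 to all indices, so that the hashing functions apply alike to points of the finite
    sample space and to the digits of the coin sequence. *)
Definition natf w (i : nat) : nat := oapp (fun k => w k : nat) 0 (insub i).

Lemma natfE w (i : 'I_K) : natf w i = w i.
Proof. by rewrite /natf valK. Qed.

Lemma natf_setf w i v k : natf (setf w i v) k = if k == i then v : nat else natf w k.
Proof.
rewrite /natf; case: insubP => [u _ <-|h] /=; first by rewrite ffunE (inj_eq val_inj); case: eqP.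
by case: eqP => // kE; move: h; rewrite kE ltn_ord.
Qed.

(** Resampling one coordinate preserves the uniform measure: exchanging the old value with the fresh
    one is an involution on pairs. This plays the role of conditioning on all other coordinates. *)
Lemma sum_setf i (F : {ffun 'I_K -> 'I_H} -> nat) :
  \sum_w \sum_v F (setf w i v) = H * \sum_w F w.
Proof.
rewrite pair_big /=.
pose h (p : {ffun 'I_K -> 'I_H} * 'I_H) := (setf p.1 i p.2, p.1 i).
have hK : involutive h.
  move=> [w v]; rewrite /h /= ffunE eqxx; congr pair.
  by apply/ffunP => k; rewrite !ffunE; case: eqP => [->|].
rewrite (reindex_inj (inv_inj hK)) /=.
rewrite (eq_bigr (fun p => F p.1)); last first.
  by move=> [w v] _; congr F; have [] := hK (w, v).
rewrite -(pair_big xpredT xpredT (fun w _ => F w)) /= big_distrr /=.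
by apply: eq_bigr => w _; rewrite sum_nat_const card_ord.
Qed.

End Functions.

Lemma sum_mod m J (F : nat -> nat) :
  \sum_(v < m * J) F (v %% J) = m * \sum_(v < J) F v.
Proof.
elim: m => [|m ih]; first by rewrite !mul0n big_ord0.
rewrite !mulSn big_split_ord /=; congr (_ + _).
  by apply: eq_bigr => v _; rewrite modn_small.
by rewrite -ih; apply: eq_bigr => v _; rewrite modnDl.
Qed.

Lemma sum_congr m J c d : 0 < J -> \sum_(v < m * J) (c + v == d %[mod J]) = m.
Proof.
move=> J0; rewrite (eq_bigr (fun v : 'I__ => (c + v %% J == d %[mod J]) : nat)); last first.
  by move=> v _; rewrite modnDmr.
rewrite (sum_mod m J (fun v => (c + v == d %[mod J]) : nat)).
(* The unique residue solving the congruence is [d - c] modulo [J], written without negative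
   numbers. *)
have lv : (d + (J - c %% J)) %% J < J by rewrite ltn_mod.
have cE : c + (J - c %% J) = (c %/ J).+1 * J.
  by rewrite {1}(divn_eq c J) -addnA subnKC ?mulSn 1?addnC // ltnW // ltn_mod.
rewrite (bigD1 (Ordinal lv)) //= big1 => [|v nv].
  by rewrite modnDmr addnCA cE (addnC d) modnMDl eqxx ?muln1.
apply/eqP; rewrite eqb0; apply: contra nv => /eqP h; apply/eqP/val_inj => /=.
rewrite -(modn_small (ltn_ord v)); apply/eqP.
rewrite -(eqn_modDl c) addnCA cE (addnC d) modnMDl h.
by [].
Qed.

(** Sending the coins to the pair of the digits of the first [g * K] bits and the remaining bits is
    injective between sets of equal size, hence bijective. The surplus coins then cancel in the
    quotient. *)
Lemma prob_fields g K m (E : (nat -> nat) -> bool) :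
  (forall f f', (forall i, i < K -> f i = f' i) -> E f = E f') ->
  g * K <= m ->
  prob m (fun r => E (field (2 ^ g) (bits_val (take (g * K) r)))) =
  (#|[set w : {ffun 'I_K -> 'I_(2 ^ g)} | E (natf w)]|%:R / (2 ^ (g * K))%:R)%R.
Proof.
move=> Eext le; rewrite /prob; set T := g * K in le *; set H := 2 ^ g.
have H0 : 0 < H by rewrite expn_gt0.
have szd (r : m.-tuple bool) : size (drop T r) == m - T by rewrite size_drop size_tuple.
pose fl (r : m.-tuple bool) : {ffun 'I_K -> 'I_H} :=
  [ffun i : 'I_K => Ordinal (ltn_pmod (bits_val (take T r) %/ H ^ i) H0)].
pose phi (r : m.-tuple bool) := (fl r, Tuple (szd r)).
have szt (r : m.-tuple bool) : size (take T r) = T by rewrite size_takel // size_tuple.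
have blt (r : m.-tuple bool) : bits_val (take T r) < H ^ K.
  by rewrite -expnM -/T -{2}(szt r) bits_val_lt.
have phi_inj : injective phi.
  move=> r r' [/ffunP efl edrop]; apply: val_inj => /=.
  rewrite -(cat_take_drop T r) -(cat_take_drop T r') edrop; congr cat.
  apply: bits_val_inj; first by rewrite !szt.
  apply: (field_inj (blt r) (blt r')) => i iK.
  by have := efl (Ordinal iK); rewrite !ffunE => /(congr1 val).
have card_eq : #|{: {ffun 'I_K -> 'I_H} * (m - T).-tuple bool}| <= #|{: m.-tuple bool}|.
  by rewrite card_prod card_ffun !card_ord !card_tuple card_bool -expnM -expnD subnKC.
have bij := inj_card_bij phi_inj card_eq.
have -> : [set r : m.-tuple bool | E (field H (bits_val (take T r)))] =
    phi @^-1: setX [set w | E (natf w)] setT.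
  apply/setP => r; rewrite !inE /= andbT; apply: Eext => i iK.
  by rewrite -[i]/(val (Ordinal iK)) natfE ffunE.
rewrite on_card_preimset; last exact: onW_bij.
rewrite cardsX cardsT card_tuple card_bool -/T natrM -!natrX.
have -> : 2 ^ m = 2 ^ T * 2 ^ (m - T) by rewrite -expnD subnKC.
by rewrite natrM -mulf_div divff ?mulr1 // pnatr_eq0 expn_eq0.
Qed.

(** * The hashed instances *)

Definition items (I : instance) : seq nat := target I :: weights I.

Definition sum_items (I : instance) : nat := sumn (items I).

Definition beta (I : instance) : nat := (trunc_log 2 (trunc_log 2 (sum_items I))).+1.

Definition tab_log (I : instance) : nat := (2 * beta I).+1.

Definition tab_size (I : instance) : nat := 2 ^ tab_log I.

(** A random table prime divides a fixed nonzero number below [2 ^ G] with probability at most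
    [G / N], which is [2 ^ -(beta + 1)]; this many factors bring the product of these probabilities
    down to [2 ^ -(2n + 4)]. *)
Definition nfactors (I : instance) : nat := ((2 * nelem I + 4) %/ (beta I).+1).+1.

(** One width serves two purposes: a table index is a field modulo [N], and a lifting multiplier is
    a field read modulo [2 ^ j] with [j] at most [n + 2]. The range [2 ^ (n + 1) * N] is a product
    of two numbers that the program already holds. *)
Definition field_width (I : instance) : nat := tab_log I + (nelem I).+1.

Definition nfields (I : instance) : nat := nfactors I + (nelem I).+1.

Definition prime_table (I : instance) : seq nat := primes_below (2 ^ (2 * tab_log I)).

Definition modulus (I : instance) (f : nat -> nat) : nat :=
  \prod_(i < nfactors I) nth 0 (prime_table I) (f i %% tab_size I).

Definition hashed (I : instance) (f : nat -> nat) (i : nat) : nat :=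
  nth 0 (items I) i %% modulus I f + modulus I f * f (nfactors I + i).

Definition hash_instance (I : instance) (f : nat -> nat) (j k : nat) : instance :=
  let Q := modulus I f * 2 ^ j in
  Instance [seq hashed I f i %% Q | i <- iota 1 (nelem I)]
           (hashed I f 0 %% Q + k * Q).

Definition hash_instances (I : instance) (f : nat -> nat) : seq instance :=
  flatten (mkseq (fun j => mkseq (hash_instance I f j) (nelem I)) (nelem I + 3)).

(** The length is a parameter, so that candidate vectors for the input and for the hashed instances
    have one common type, although their numbers of elements are only provably equal. *)
Definition dot n (w : seq nat) (x : n.-tuple bool) : nat :=
  \sum_(i < n) nth 0 w i * tnth x i.

Lemma nsolE n w t : size w = n ->
  nsol (Instance w t) = #|[set x : n.-tuple bool | dot w x == t]|.
Proof. by move=> <-. Qed.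

Lemma solvableP n w t : size w = n ->
  reflect (exists x : n.-tuple bool, dot w x = t) (solvable (Instance w t)).
Proof.
move=> <-; apply: (iffP existsP) => -[x h]; exists x; first exact/eqP.
exact/eqP.
Qed.

Lemma dot_le n w (x : n.-tuple bool) : dot w x <= \sum_(i < n) nth 0 w i.
Proof. by apply: leq_sum => i _; case: (tnth x i); rewrite ?muln1 ?muln0. Qed.

Lemma sumn_nth (w : seq nat) : sumn w = \sum_(i < size w) nth 0 w i.
Proof. by rewrite sumnE (big_nth 0) big_mkord. Qed.

Lemma eqn_mod_sum n d (F G : 'I_n -> nat) (x : n.-tuple bool) :
  (forall i, F i = G i %[mod d]) ->
  \sum_i F i * tnth x i = \sum_i G i * tnth x i %[mod d].
Proof.
move=> h; elim/big_rec2: _ => // i a b _ e.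
by rewrite -modnDm e -modnMml h modnMml modnDm.
Qed.

Section Hash.

Variables (I : instance) (f : nat -> nat).
Local Notation n := (nelem I).
Local Notation P := (modulus I f).

Definition hash_ok (j : nat) (x : n.-tuple bool) : bool :=
  \sum_(i < n) hashed I f i.+1 * tnth x i == hashed I f 0 %[mod P * 2 ^ j].

Hypothesis P_gt0 : 0 < P.

Let Q_gt0 j : 0 < P * 2 ^ j.
Proof. by rewrite muln_gt0 P_gt0 expn_gt0. Qed.

Lemma size_hash_weights j k : size (weights (hash_instance I f j k)) = n.
Proof. by rewrite size_map size_iota. Qed.

Lemma nth_hash_weights j k (i : 'I_n) :
  nth 0 (weights (hash_instance I f j k)) i = hashed I f i.+1 %% (P * 2 ^ j).
Proof. by rewrite (nth_map 0) ?size_iota // nth_iota. Qed.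

Lemma dot_hash_mod j k (x : n.-tuple bool) :
  dot (weights (hash_instance I f j k)) x =
    \sum_(i < n) hashed I f i.+1 * tnth x i %[mod P * 2 ^ j].
Proof.
by apply: eqn_mod_sum => i; rewrite nth_hash_weights modn_mod.
Qed.

Lemma hash_solution_ok j k (x : n.-tuple bool) :
  dot (weights (hash_instance I f j k)) x = target (hash_instance I f j k) ->
  hash_ok j x.
Proof.
by move=> h; rewrite /hash_ok -(dot_hash_mod j k) h /= addnC modnMDl modn_mod.
Qed.

(** The carry is the quotient of the reduced dot product by [Q]. It is below [n] because [n]
    residues, each below [Q], sum to less than [n * Q] when [n] is positive. *)
Lemma ok_hash_solution j (x : n.-tuple bool) : 0 < n -> hash_ok j x ->
  exists2 k, k < n &
    dot (weights (hash_instance I f j k)) x = target (hash_instance I f j k).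
Proof.
move=> n0 /eqP ok; set Q := P * 2 ^ j.
pose d := dot (weights (hash_instance I f j 0)) x.
exists (d %/ Q); last first.
  rewrite /= -/Q addnC -ok -(dot_hash_mod j 0) -divn_eq.
  by [].
rewrite ltn_divLR; last exact: Q_gt0.
rewrite /d; apply: (leq_ltn_trans (dot_le _ _)).
have -> : n * Q = \sum_(i < n) Q by rewrite sum_nat_const card_ord.
rewrite (eq_bigr (fun i : 'I_n => hashed I f i.+1 %% Q)) => [|i _]; last exact: nth_hash_weights.
case: (n) n0 => // m _; rewrite !big_ord_recl.
have Q0 : 0 < Q := Q_gt0 j.
rewrite -addSn; apply: leq_add; first by rewrite ltn_mod.
by apply: leq_sum => i _; rewrite ltnW ?ltn_mod.
Qed.

Lemma hash_ok_mod j (x : n.-tuple bool) : hash_ok j x ->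
  dot (weights I) x = target I %[mod P].
Proof.
move/eqP => ok; have : \sum_(i < n) hashed I f i.+1 * tnth x i = hashed I f 0 %[mod P].
  by rewrite -(modn_dvdm _ (dvdn_mulr (2 ^ j) (dvdnn P))) ok modn_dvdm ?dvdn_mulr.
have hE i : hashed I f i = nth 0 (items I) i %[mod P].
  by rewrite /hashed addnC mulnC modnMDl modn_mod.
rewrite hE => <-; apply: eqn_mod_sum => i; by rewrite hE.
Qed.

(** This is the [alpha_x] of the overview. It depends on [f] through [P] alone, thus only on the
    first [nfactors I] fields. *)
Definition quotient_dot (x : n.-tuple bool) : nat :=
  (\sum_(i < n) (nth 0 (weights I) i %% P) * tnth x i) %/ P.

Lemma hash_ok_linear j (x : n.-tuple bool) : dot (weights I) x = target I ->
  hash_ok j x =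
    (quotient_dot x + \sum_(i < n) f (nfactors I + i.+1) * tnth x i
       == f (nfactors I) %[mod 2 ^ j]).
Proof.
move=> sol; rewrite /hash_ok.
have -> : \sum_(i < n) hashed I f i.+1 * tnth x i =
   \sum_(i < n) (nth 0 (weights I) i %% P) * tnth x i +
   P * \sum_(i < n) f (nfactors I + i.+1) * tnth x i.
  by rewrite big_distrr -big_split /=; apply: eq_bigr => i _; rewrite /hashed mulnDl mulnA.
have e : (\sum_(i < n) (nth 0 (weights I) i %% P) * tnth x i) %% P = target I %% P.
  by rewrite -sol; apply: eqn_mod_sum => i; rewrite modn_mod.
rewrite [X in X + _](divn_eq _ P) e -/(quotient_dot x) /hashed addn0 /=.
rewrite addnAC addnC eqn_modDl mulnC -mulnDr -!muln_modr eqn_pmul2l //.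
Qed.

End Hash.

Arguments hash_ok : clear implicits.
Arguments quotient_dot : clear implicits.

(** * Spurious solutions *)

Lemma sum_items_lt I : sum_items I < 2 ^ (2 ^ beta I).
Proof.
rewrite /beta; set V := sum_items I; apply: leq_trans (trunc_log_ltn V (isT : 1 < 2)) _.
by rewrite leq_exp2l // trunc_log_ltn.
Qed.

Lemma tab_log_ge3 I : 3 <= tab_log I.
Proof. by rewrite /tab_log /beta; lia. Qed.

Lemma tab_sizeE I : tab_size I = 2 * (2 ^ beta I * 2 ^ beta I).
Proof. by rewrite /tab_size /tab_log expnS -expnD addnn -(mul2n (beta I)). Qed.

Lemma tab_size_gt0 I : 0 < tab_size I.
Proof. by rewrite expn_gt0. Qed.

Lemma field_rangeE I : 2 ^ field_width I = 2 ^ (nelem I).+1 * tab_size I.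
Proof. by rewrite expnD mulnC. Qed.

Lemma nfactors_lb I : 2 * nelem I + 4 <= (beta I).+1 * nfactors I.
Proof. by rewrite /nfactors [leqRHS]mulnC ltnW // ltn_ceil. Qed.

Lemma nfactors_ub I : (beta I).+1 * nfactors I <= 2 * nelem I + 4 + (beta I).+1.
Proof. by rewrite /nfactors mulnS addnC leq_add2r [leqLHS]mulnC leq_trunc_div. Qed.

Lemma nth_prime_table I c : c < tab_size I ->
  prime (nth 0 (prime_table I) c) && (nth 0 (prime_table I) c < 2 ^ (2 * tab_log I)).
Proof.
move=> lc; have le := many_primes (tab_log_ge3 I).
have := mem_nth 0 (leq_trans lc le : c < size (prime_table I)).
rewrite mem_filter mem_iota => /and3P[-> h2 /=].
by rewrite subnKC // (leq_exp2l 1) // /tab_log.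
Qed.

Lemma prime_table_uniq I : uniq (prime_table I).
Proof. by rewrite filter_uniq // iota_uniq. Qed.

Lemma modulus_gt0 I f : 0 < modulus I f.
Proof.
rewrite prodn_gt0 // => i.
by have /andP[/prime_gt0] := nth_prime_table (ltn_pmod (f i) (tab_size_gt0 I)).
Qed.

Lemma modulus_ub I f : modulus I f <= 2 ^ (2 * tab_log I * nfactors I).
Proof.
rewrite expnM -[X in _ ^ X]card_ord -prod_nat_const; apply: leq_prod => i _.
by have /andP[_ /ltnW] := nth_prime_table (ltn_pmod (f i) (tab_size_gt0 I)).
Qed.

Lemma modulus_eq I f f' : (forall i, i < nfactors I -> f i = f' i) ->
  modulus I f = modulus I f'.
Proof. by move=> e; apply: eq_bigr => i _; rewrite e. Qed.

Lemma size_primes_le d G : 0 < d -> d < 2 ^ G -> size (primes d) <= G.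
Proof.
move=> d0 dG; suff h : 2 ^ size (primes d) <= d.
  by rewrite ltnW // -(@ltn_exp2l 2) // (leq_ltn_trans h).
rewrite [leqRHS](prod_prime_decomp d0) prime_decompE big_map /=.
have : all (fun p => 0 < logn p d) (primes d).
  by apply/allP => p; rewrite logn_gt0.
have : all prime (primes d) by apply/allP => p; rewrite mem_primes => /and3P[].
elim: (primes d) => [|p s ih] /=; first by rewrite big_nil.
move=> /andP[pp ps] /andP[lp ls]; rewrite big_cons expnS leq_mul ?ih //.
by apply: leq_trans (prime_gt1 pp) _; rewrite -{1}(expn1 p) leq_exp2l ?prime_gt1.
Qed.

Lemma count_table_divisors I d : 0 < d -> d < 2 ^ (2 ^ beta I) ->
  \sum_(c < tab_size I) (nth 0 (prime_table I) c %| d) <= 2 ^ beta I.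
Proof.
move=> d0 dG; apply: leq_trans (size_primes_le d0 dG).
have le := many_primes (tab_log_ge3 I).
apply: leq_trans (_ : \sum_(p <- prime_table I) (p %| d : nat) <= _).
  rewrite (big_nth 0) -(big_mkord xpredT (fun c => (nth 0 (prime_table I) c %| d) : nat)).
  by rewrite [leqRHS](@big_cat_nat _ _ _ (tab_size I)) //= leq_addr.
have -> : \sum_(p <- prime_table I) (p %| d : nat) = size [seq p <- prime_table I | p %| d].
  by rewrite size_filter -sum1_count [RHS]big_mkcond; apply: eq_bigr => p _; case: (_ %| _).
apply: uniq_leq_size => [|p]; first by rewrite filter_uniq // prime_table_uniq.
by rewrite !mem_filter mem_primes d0 => /and3P[-> -> _].
Qed.

Section Count.

Variable I : instance.
Local Notation n := (nelem I).
Local Notation K := (nfields I).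
Local Notation H := (2 ^ field_width I).
Local Notation Omega := {ffun 'I_K -> 'I_H}.

Lemma card_Omega : #|{: Omega}| = 2 ^ (field_width I * nfields I).
Proof. by rewrite card_ffun !card_ord expnM. Qed.

(** If [P] divides [d] then so does each of its factors. The event is thus bounded by a product of
    indicators, each of a single field, and the sum over all [w] factorizes. Only this direction is
    used, so repeated primes cause no trouble. *)
Lemma card_modulus_dvd d : 0 < d -> d < 2 ^ (2 ^ beta I) ->
  #|[set w : Omega | modulus I (natf w) %| d]| * 2 ^ (2 * n + 4) <= #|{: Omega}|.
Proof.
move=> d0 dG; set N := tab_size I; set s := nfactors I; set G := 2 ^ beta I.
pose F (i : nat) (v : 'I_H) : nat :=
  if i < s then nth 0 (prime_table I) (v %% N) %| d : nat else 1.
have le1 : #|[set w : Omega | modulus I (natf w) %| d]| <=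
    \sum_(w : Omega) \prod_(i < K) F i (w i).
  rewrite -sum1_card big_mkcond /=; apply: leq_sum => w _; rewrite inE.
  case: ifP => // dv; rewrite prodn_gt0 // => i; rewrite /F; case: ifP => // lis.
  rewrite lt0b (dvdn_trans _ dv) // /modulus (bigD1 (Ordinal lis)) //=.
  by rewrite natfE dvdn_mulr.
rewrite -(bigA_distr_bigA (fun (i : 'I_K) (v : 'I_H) => F i v)) /= in le1.
have HE : H = 2 ^ n.+1 * N by rewrite field_rangeE.
have Fs i : \sum_(v : 'I_H) F i v <= if i < s then 2 ^ n.+1 * G else H.
  rewrite /F; case: ifP => _; last by rewrite sum_nat_const card_ord muln1.
  rewrite HE (sum_mod _ _ (fun c => (nth 0 (prime_table I) c %| d) : nat)).
  by rewrite leq_mul2l count_table_divisors ?orbT.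
have le2 : \prod_(i < K) \sum_v F i v <= (2 ^ n.+1 * G) ^ s * H ^ n.+1.
  apply: leq_trans (leq_prod _) _; first by move=> i _; apply: Fs.
  rewrite /nfields big_split_ord /=; apply: leq_mul.
    by rewrite (eq_bigr (fun=> 2 ^ n.+1 * G)) => [|i _]; rewrite ?prod_nat_const ?card_ord ?ltn_ord.
  rewrite (eq_bigr (fun=> H)) => [|i _]; rewrite ?prod_nat_const ?card_ord //.
  by rewrite ltnNge leq_addr.
apply: leq_trans (leq_mul (leq_trans le1 le2) (leqnn _)) _.
rewrite card_Omega expnM /nfields (expnD H) mulnAC leq_mul2r; apply/orP; right.
have -> : H = (2 ^ n.+1 * G) * 2 ^ (beta I).+1.
  by rewrite HE /N tab_sizeE (expnS 2 (beta I)) -/G; ring.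
by rewrite (expnMn _ (2 ^ (beta I).+1)) leq_mul2l -expnM leq_exp2l // nfactors_lb orbT.
Qed.

(* Union bound over the [2 ^ n] candidate vectors. *)
Lemma card_spurious :
  #|[set w : Omega | [exists x : n.-tuple bool,
      (dot (weights I) x != target I) &&
      (dot (weights I) x == target I %[mod modulus I (natf w)])]]| * 2 ^ (n + 4)
    <= #|{: Omega}|.
Proof.
pose B (x : n.-tuple bool) := [set w : Omega | (dot (weights I) x != target I) &&
      (dot (weights I) x == target I %[mod modulus I (natf w)])].
have sub : #|[set w : Omega | [exists x, w \in B x]]| <= \sum_x #|B x|.
  apply: leq_trans (_ : #|\bigcup_x B x| <= _).
    apply: subset_leq_card; apply/subsetP => w; rewrite inE => /existsP[x xB].
    by apply/bigcupP; exists x.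
  elim/big_ind2: _ => [|A a A' a' h h'|x _]; [by rewrite cards0 | | by []].
  by rewrite (leq_trans (leq_card_setU _ _)) ?leq_add.
have Bx x : #|B x| * 2 ^ (2 * n + 4) <= #|{: Omega}|.
  case: (eqVneq (dot (weights I) x) (target I)) => [e|ne].
    by rewrite (_ : B x = set0) ?cards0 //; apply/setP => w; rewrite !inE e eqxx.
  set y := dot (weights I) x in ne *; set t := target I in ne *.
  have yt : y + t < 2 ^ (2 ^ beta I).
    apply: leq_ltn_trans (sum_items_lt I); rewrite /sum_items /= addnC leq_add2l.
    by rewrite sumn_nth dot_le.
  (* The divided number is the absolute value of [y - t]: one of the two truncated differences is
     0. *)
  apply: leq_trans (card_modulus_dvd (d := (y - t) + (t - y)) _ _); last 2 first.
  - by rewrite addn_gt0 !subn_gt0; case: ltngtP ne.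
  - by apply: leq_ltn_trans yt; lia.
  rewrite leq_mul2r; apply/orP; right; apply: subset_leq_card; apply/subsetP => w.
  rewrite !inE ne /=; case/orP: (leq_total y t) => h.
    by rewrite eq_sym eqn_mod_dvd // (eqP h).
  by rewrite eqn_mod_dvd // (eqP h) addn0.
rewrite (_ : [set w : Omega | _] = [set w : Omega | [exists x, w \in B x]]); last first.
  by apply/setP => w; rewrite !inE; apply: eq_existsb => x; rewrite inE.
have e : 2 ^ (2 * n + 4) = 2 ^ n * 2 ^ (n + 4) by rewrite -expnD addnA mul2n addnn.
have p0 : 0 < 2 ^ n by rewrite expn_gt0.
rewrite -(leq_pmul2l p0) mulnCA -e.
apply: leq_trans (leq_mul sub (leqnn _)) _; rewrite big_distrl /=.
apply: leq_trans (leq_sum _ (fun x _ => Bx x)) _.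
by rewrite sum_nat_const card_tuple card_bool.
Qed.

End Count.

(** * Isolation *)

Section Isolation.

Variable I : instance.
Local Notation n := (nelem I).
Local Notation s := (nfactors I).
Local Notation K := (nfields I).
Local Notation H := (2 ^ field_width I).
Local Notation Omega := {ffun 'I_K -> 'I_H}.

Definition solutions : {set n.-tuple bool} :=
  [set x : n.-tuple bool | dot (weights I) x == target I].

Lemma offset_lt : s < K. Proof. by rewrite /nfields; lia. Qed.
Lemma coef_lt (i : 'I_n) : s + i.+1 < K.
Proof. by rewrite /nfields ltn_add2l ltnS. Qed.

Let off := Ordinal offset_lt.
Let coef i := Ordinal (coef_lt i).

Variable j : nat.
Hypothesis j_le : j <= field_width I.

Let m := 2 ^ (field_width I - j).
Let HE : H = m * 2 ^ j.
Proof. by rewrite -expnD subnK. Qed.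

Let J0 : 0 < 2 ^ j.
Proof. by rewrite expn_gt0. Qed.

Definition linear_part (w : Omega) (x : n.-tuple bool) (i0 : 'I_n) : nat :=
  quotient_dot I (natf w) x + \sum_(i < n | i != i0) natf w (s + i.+1) * tnth x i.

(** Changing a field from position [s] on leaves the modulus alone; this is the independence of
    [alpha_x] from the multipliers. *)
Lemma quotient_dot_setf (w : Omega) (k : 'I_K) v x : s <= k ->
  quotient_dot I (natf (setf w k v)) x = quotient_dot I (natf w) x :> nat.
Proof.
move=> sk; rewrite /quotient_dot.
rewrite (@modulus_eq I (natf (setf w k v)) (natf w)) // => i lis.
by rewrite natf_setf; case: eqP => // e; move: lis; rewrite e ltnNge sk.
Qed.

Lemma hash_ok_setf_offset (w : Omega) v x : x \in solutions ->
  hash_ok I (natf (setf w off v)) j x =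
    (quotient_dot I (natf w) x + \sum_(i < n) natf w (s + i.+1) * tnth x i
       == v %[mod 2 ^ j]).
Proof.
rewrite inE => /eqP sol; rewrite hash_ok_linear ?modulus_gt0 //.
rewrite quotient_dot_setf // natf_setf eqxx.
congr (_ + _ == _ %[mod _]); apply: eq_bigr => i _.
by rewrite natf_setf /=; case: eqP => //; lia.
Qed.

Lemma sum_setf_coef (w : Omega) i0 u x :
  quotient_dot I (natf (setf w (coef i0) u)) x +
    \sum_(i < n) natf (setf w (coef i0) u) (s + i.+1) * tnth x i =
  linear_part w x i0 + u * tnth x i0.
Proof.
rewrite quotient_dot_setf ?leq_addr // /linear_part -addnA; congr (_ + _).
rewrite (bigD1 i0) //= natf_setf eqxx addnC; congr (_ + _).
apply: eq_bigr => i ne; rewrite natf_setf /=; case: eqP => // e.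
by case/eqP: ne; apply: val_inj; move: e => /addnI [].
Qed.

(** Resample the multiplier of the target: with all other fields fixed, exactly one residue of it
    modulo [2 ^ j] lets [x] pass. *)
Lemma first_moment x : x \in solutions ->
  2 ^ j * \sum_(w : Omega) hash_ok I (natf w) j x = #|{: Omega}|.
Proof.
move=> xS; have H0 : 0 < H by rewrite expn_gt0.
apply/eqP; rewrite -(eqn_pmul2l H0) mulnCA.
rewrite -(sum_setf off (fun w : Omega => hash_ok I (natf w) j x : nat)).
rewrite (eq_bigr (fun=> m)) => [|w _].
  by rewrite sum_nat_const mulnCA [2 ^ j * m]mulnC -HE mulnC.
rewrite -[RHS](sum_congr m 0 (quotient_dot I (natf w) x +
  \sum_(i < n) natf w (s + i.+1) * tnth x i) J0) -HE.
by apply: eq_bigr => v _; rewrite hash_ok_setf_offset // eq_sym.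
Qed.

(** Resample two fields, the multiplier [u] of element [i0] and the multiplier [v] of the target. As
    [y] does not use [i0], it passes for one residue of [v], whatever [u] is; given that, [x] passes
    for one residue of [u]. This yields pairwise independence. *)
Lemma second_moment_sep x y i0 : x \in solutions -> y \in solutions ->
  tnth x i0 -> ~~ tnth y i0 ->
  2 ^ j * (2 ^ j * \sum_(w : Omega) (hash_ok I (natf w) j x && hash_ok I (natf w) j y)) =
  #|{: Omega}|.
Proof.
move=> xS yS xi yi; have H0 : 0 < H by rewrite expn_gt0.
pose F (w : Omega) : nat := hash_ok I (natf w) j x && hash_ok I (natf w) j y.
suff e : H * (H * \sum_w F w) = #|{: Omega}| * (m * m).
  have m0 : 0 < m * m by rewrite muln_gt0 !expn_gt0.
  apply/eqP; rewrite -(eqn_pmul2r m0) -e -/F; apply/eqP.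
  by move: (\sum_(w : Omega) _) => T; rewrite HE; ring.
rewrite -(sum_setf off F) -(sum_setf (coef i0) (fun w => \sum_v F (setf w off v))).
rewrite -sum_nat_const; apply: eq_bigr => w _.
rewrite -{1}(sum_congr m (linear_part w x i0) (linear_part w y i0) J0) -HE.
rewrite big_distrl /=; apply: eq_bigr => u _.
rewrite -[X in _ * X](sum_congr m 0 (linear_part w y i0) J0) -HE.
rewrite big_distrr /=; apply: eq_bigr => v _.
rewrite /F !hash_ok_setf_offset // !sum_setf_coef xi (negPf yi) muln1 muln0 addn0 add0n.
rewrite mulnb andbC [in RHS]andbC eq_sym; case: eqP => //= ->.
by [].
Qed.

Lemma second_moment x y : x \in solutions -> y \in solutions -> x != y ->
  2 ^ j * (2 ^ j * \sum_(w : Omega) (hash_ok I (natf w) j x && hash_ok I (natf w) j y)) =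
  #|{: Omega}|.
Proof.
move=> xS yS; case: (boolP [forall i, tnth x i == tnth y i]) => [/eqfunP h|].
  by case/eqP; apply: eq_from_tnth.
rewrite negb_forall => /existsP[i0 ne] _.
have [xi|xi] := boolP (tnth x i0).
  by apply: (second_moment_sep xS yS xi); move: ne; rewrite xi; case: (tnth y i0).
under eq_bigr do rewrite andbC.
apply: (second_moment_sep yS xS _ xi); move: ne; rewrite (negPf xi).
by case: (tnth y i0).
Qed.

Definition passing (w : Omega) : {set n.-tuple bool} :=
  [set x in solutions | hash_ok I (natf w) j x].

(* Valiant--Vazirani: [N <= [N = 1] + N (N - 1)], summed over all [w]. *)
Lemma isolated_lb :
  #|solutions| * #|{: Omega}| * 2 ^ j <=
  #|[set w : Omega | #|passing w| == 1]| * 2 ^ j * 2 ^ j +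
  #|solutions| * #|solutions| * #|{: Omega}|.
Proof.
set M := #|solutions|.
pose ok (w : Omega) x : nat := hash_ok I (natf w) j x.
pose ok2 (w : Omega) x y : nat := hash_ok I (natf w) j x && hash_ok I (natf w) j y.
have pE w : #|passing w| = \sum_(x in solutions) ok w x.
  rewrite -sum1_card [RHS](bigID (fun x => hash_ok I (natf w) j x)) /=.
  rewrite [X in _ = _ + X]big1 ?addn0 => [|x /andP[_ /negPf]]; last by rewrite /ok => ->.
  under eq_bigl do rewrite inE.
  by apply: eq_bigr => x /andP[_ h]; rewrite /ok h.
have pt (w : Omega) : \sum_(x in solutions) ok w x <= (#|passing w| == 1) +
    \sum_(x in solutions) \sum_(y in solutions | x != y) ok2 w x y.
  have sq : #|passing w| * #|passing w| = #|passing w| +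
      \sum_(x in solutions) \sum_(y in solutions | x != y) ok2 w x y.
    rewrite pE big_distrl -big_split /=; apply: eq_bigr => x xS.
    rewrite big_distrr (bigD1 x) //=; congr (_ + _).
      by rewrite /ok mulnb andbb.
    by apply: eq_big => y; [rewrite eq_sym | rewrite /ok2 /ok mulnb].
  move: sq; rewrite -pE; move: #|_| (\sum_(x in _) _) => N T.
  by case: N => [|[|N]] //=; nia.
have := leq_sum (index_enum Omega) (P := xpredT) (fun w _ => pt w).
rewrite big_split /= exchange_big /= => h.
have {}h := leq_mul (leq_mul h (leqnn (2 ^ j))) (leqnn (2 ^ j)).
apply: leq_trans (leq_trans h _).
  rewrite leq_mul2r; apply/orP; right; rewrite big_distrl /=.
  rewrite /M -sum_nat_const; apply: leq_sum => x xS.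
  by rewrite mulnC /ok first_moment.
rewrite !mulnDl; apply: leq_add.
  rewrite !leq_mul2r -sum1_card [leqRHS]big_mkcond /=; apply/orP; right.
  by apply/orP; right; apply: leq_sum => w _; rewrite inE; case: eqP.
rewrite exchange_big /= !big_distrl /= -mulnA.
rewrite /M -[leqRHS]sum_nat_const; apply: leq_sum => x xS.
rewrite exchange_big /= !big_distrl /=.
rewrite -sum_nat_const [leqRHS](bigID (fun y => x != y)) /=.
apply: leq_trans (leq_addr _ _); apply: leq_sum => y /andP[yS ne].
by rewrite mulnC [X in _ * X]mulnC /ok2 second_moment.
Qed.

End Isolation.

(** * From isolation to the output instances *)

Lemma solvableE I : solvable I = (solutions I != set0).
Proof.
apply/existsP/set0Pn => -[x h]; exists x; first by rewrite inE.
by move: h; rewrite inE.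
Qed.

Definition spurious I (f : nat -> nat) : bool :=
  [exists x : (nelem I).-tuple bool, (dot (weights I) x != target I) &&
      (dot (weights I) x == target I %[mod modulus I f])].

Lemma all_flatten_seq (T : Type) (a : pred T) (ss : seq (seq T)) :
  all a (flatten ss) = all (all a) ss.
Proof. by elim: ss => //= s ss ih; rewrite all_cat ih. Qed.

Lemma all_hash_instances (a : pred instance) I f :
  (forall j k, j < nelem I + 3 -> k < nelem I -> a (hash_instance I f j k)) ->
  all a (hash_instances I f).
Proof.
move=> h; rewrite /hash_instances all_flatten_seq all_map; apply/allP => j.
rewrite mem_iota => /= lj; rewrite all_map; apply/allP => k.
by rewrite mem_iota /= => lk; apply: h.
Qed.

Lemma has_hash_instances (a : pred instance) I f j k :
  j < nelem I + 3 -> k < nelem I -> a (hash_instance I f j k) ->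
  has a (hash_instances I f).
Proof.
move=> lj lk h; rewrite -[has _ _]negbK -all_predC; apply/negP.
rewrite /hash_instances all_flatten_seq all_map => /allP/(_ j).
rewrite mem_iota => /(_ lj) /=; rewrite all_map => /allP/(_ k).
by rewrite mem_iota => /(_ lk) /=; rewrite h.
Qed.

Lemma size_hash_instances I f : size (hash_instances I f) = (nelem I + 3) * nelem I.
Proof.
rewrite size_flatten /shape -map_comp sumnE big_map.
rewrite (eq_bigr (fun=> nelem I)) => [|j _]; last by rewrite /= size_mkseq.
by rewrite big_const_seq count_predT size_iota iter_addn_0 mulnC.
Qed.

Lemma hash_instances_unsolvable I f : ~~ solvable I -> ~~ spurious I f ->
  all (fun J => ~~ solvable J) (hash_instances I f).
Proof.
move=> ns nsp; apply: all_hash_instances => j k _ _; apply/negP => sol.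
have [x /hash_solution_ok ok] := solvableP _ (size_hash_weights I f j k) sol.
case/negP: nsp; apply/existsP; exists x; rewrite (hash_ok_mod ok) eqxx andbT.
apply: contra ns => h; rewrite solvableE; apply/set0Pn; exists x; by rewrite inE.
Qed.

(** Any solution of a hashed instance passes the hash and, in the absence of spurious vectors,
    solves the input; so it is the only passing vector. The instance with the matching carry does
    contain that vector. *)
Lemma hash_instances_isolated I w j : 0 < nelem I -> j < nelem I + 3 ->
  ~~ spurious I (natf w) -> #|@passing I j w| == 1 ->
  has (fun J => 0 < nsol J <= 1) (hash_instances I (natf w)).
Proof.
move=> n0 lj nsp /cards1P[x xE].
have /setIdP[xS ok] : x \in @passing I j w by rewrite xE set11.
have [k lk sol] := ok_hash_solution (modulus_gt0 I _) n0 ok.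
apply: (has_hash_instances lj lk); rewrite (nsolE _ (size_hash_weights I _ j k)).
rewrite (_ : [set y | _] = [set x]) ?cards1 //; apply/setP => y.
rewrite !inE; apply/eqP/eqP => [solk|->//].
have oky := hash_solution_ok solk.
apply/set1P; rewrite -xE !inE oky andbT; apply: contraR nsp => ne.
by apply/existsP; exists y; rewrite ne (hash_ok_mod oky) eqxx.
Qed.

(** Some vector is isolated with probability at least 1/8, and a spurious vector exists with
    probability at most 1/16; the difference is 1/16. *)
Lemma card_good I : 0 < nelem I -> solvable I ->
  #|{: {ffun 'I_(nfields I) -> 'I_(2 ^ field_width I)}}| <=
  16 * #|[set w : {ffun 'I_(nfields I) -> 'I_(2 ^ field_width I)} |
      has (fun J => 0 < nsol J <= 1) (hash_instances I (natf w))]|.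
Proof.
set n := nelem I => n0; rewrite solvableE -card_gt0; set M := #|_| => M0.
have Mn : M <= 2 ^ n by rewrite (leq_trans (max_card _)) // card_tuple card_bool.
(* This puts [M / 2 ^ j] between 1/4 and 1/2, where [x (1 - x)], the lower bound from the two
   moments, exceeds 1/8. Since [M <= 2 ^ n], the exponent is at most [n + 2], whence the [n + 3]
   values tried. *)
pose j := trunc_log 2 M + 2.
have tl : trunc_log 2 M <= n.
  by rewrite -(@leq_exp2l 2) // (leq_trans (trunc_logP _ M0)).
have lj : j < n + 3 by rewrite /j; lia.
have jw : j <= field_width I.
  by rewrite /field_width -/n; have := tab_log_ge3 I; rewrite /j; lia.
have J1 : 2 * M < 2 ^ j.
  rewrite /j addn2 expnS ltn_mul2l /=; exact: trunc_log_ltn.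
have J2 : 2 ^ j <= 4 * M.
  by rewrite /j addnC expnD leq_mul2l /=; exact: trunc_logP.
have := isolated_lb jw; have := card_spurious I; rewrite -/M -/n.
set Om := #|{: {ffun 'I_(nfields I) -> 'I_(2 ^ field_width I)}}|.
set A := #|_|; set B := #|_| => hA hB.
have {}hA : 16 * A <= Om.
  by apply: (leq_trans _ hA); rewrite mulnC leq_mul2l -[16]/(2 ^ 4) leq_exp2l // leq_addl orbT.
have {}hB : Om <= 8 * B.
  move: hB J1 J2; rewrite -mulnA; set J := 2 ^ j => hB J1 J2.
  have J0 : 0 < J by lia.
  rewrite -(@leq_pmul2r (J * J)) ?muln_gt0 ?J0 //.
  have e1 : Om * (J * J) <= 8 * Om * (M * (J - M)).
    have [k kE] : exists k, J = 2 * M + k by exists (J - 2 * M); lia.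
    have kM : k <= 2 * M by lia.
    have : J * J <= 8 * (M * (J - M)).
      rewrite kE; have -> : 2 * M + k - M = M + k by lia.
      nia.
    by move=> h; rewrite mulnAC -!mulnA mulnC [leqRHS]mulnC; nia.
  apply: (leq_trans e1); rewrite mulnBr; nia.
have sub : B <= A + #|[set w : {ffun 'I_(nfields I) -> 'I_(2 ^ field_width I)} |
      has (fun J => 0 < nsol J <= 1) (hash_instances I (natf w))]|.
  apply: leq_trans (leq_card_setU _ _); apply: subset_leq_card; apply/subsetP => w.
  rewrite inE => iso; rewrite in_setU; case: (boolP (spurious I (natf w))) => [sp|nsp].
    by apply/orP; left; rewrite inE.
  by apply/orP; right; rewrite inE (hash_instances_isolated n0 lj nsp iso).
lia.
Qed.

(** * The program *)

Definition St rg v pr i w o := State (lay rg v pr) i w o.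

Definition reg c := Deref (Const c).

Definition Mod a b := Monus a (Mul (Div a b) b).

Declare Scope cmd_scope.
Delimit Scope cmd_scope with C.
Notation "c1 ;; c2" := (Seq c1 c2)
  (at level 90, right associativity, format "c1 ;;  '/' c2") : cmd_scope.
Notation "c <~ e" := (Store (Const c) e) (at level 80, no associativity) : cmd_scope.

Definition For c N body :=
  (c <~ Const 0 ;;
   While (Monus N (reg c)) (body ;; c <~ Add (Const 1) (reg c)))%C.

Definition item_at e := Add (Const 16) (Mul (Const 2) e).
(** Shifted by one cell of the item array, because item 0 is the target. *)
Definition weight_at e := Add (Const 18) (Mul (Const 2) e).
Definition prime_at e := Add (Const 17) (Mul (Const 2) e).

Lemma eval_Mod M a b : eval M (Mod a b) = eval M a %% eval M b.
Proof. by rewrite /= {1}(divn_eq (eval M a) (eval M b)) addKn. Qed.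

Lemma lay_lit rg v pr :
  ((lay rg v pr 0 = nth 0 rg 0) * (lay rg v pr 1 = nth 0 rg 1) *
   (lay rg v pr 2 = nth 0 rg 2) * (lay rg v pr 3 = nth 0 rg 3) *
   (lay rg v pr 4 = nth 0 rg 4) * (lay rg v pr 5 = nth 0 rg 5) *
   (lay rg v pr 6 = nth 0 rg 6) * (lay rg v pr 7 = nth 0 rg 7) *
   (lay rg v pr 8 = nth 0 rg 8) * (lay rg v pr 9 = nth 0 rg 9) *
   (lay rg v pr 10 = nth 0 rg 10) * (lay rg v pr 11 = nth 0 rg 11) *
   (lay rg v pr 12 = nth 0 rg 12) * (lay rg v pr 13 = nth 0 rg 13) *
   (lay rg v pr 14 = nth 0 rg 14) * (lay rg v pr 15 = nth 0 rg 15) *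
   (lay rg v pr 16 = nth 0 v 0))%type.
Proof. by []. Qed.

Ltac ev := rewrite /= ?lay_lit /= ?lay_v ?lay_v1 ?lay_pr /=.

Lemma eval_reg rg v pr c : c < 16 -> eval (lay rg v pr) (reg c) = nth 0 rg c.
Proof. by rewrite /= /lay => ->. Qed.

Section Rules.

Variables (X : nat) (X_gt0 : 0 < X).

Lemma runs_set rg v pr i w o c e x :
  c < 16 -> eval (lay rg v pr) e = x -> x < 2 ^ X ->
  runs X (c <~ e)%C (St rg v pr i w o) (St (set_nth 0 rg c x) v pr i w o) 1.
Proof. by move=> c16 ex lx; apply: runs_store; rewrite // ex // upd_reg. Qed.

Lemma runs_set_item rg v pr i w o a e k x :
  eval (lay rg v pr) a = k -> eval (lay rg v pr) e = x -> x < 2 ^ X ->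
  runs X (Store (item_at a) e) (St rg v pr i w o) (St rg (set_nth 0 v k x) pr i w o) 1.
Proof.
by move=> ka ex lx; apply: runs_store; rewrite // ex // -(upd_v _ _ _ k) -ka.
Qed.

Lemma runs_set_prime rg v pr i w o a e k x :
  eval (lay rg v pr) a = k -> eval (lay rg v pr) e = x -> x < 2 ^ X ->
  runs X (Store (prime_at a) e) (St rg v pr i w o) (St rg v (set_nth 0 pr k x) i w o) 1.
Proof.
by move=> ka ex lx; apply: runs_store; rewrite // ex // -(upd_pr _ _ _ k) -ka.
Qed.

Lemma runs_read_reg rg v pr i w o c x : c < 16 -> x < 2 ^ X ->
  runs X (Read (Const c)) (St rg v pr (x :: i) w o) (St (set_nth 0 rg c x) v pr i w o) 1.
Proof. by move=> c16 lx; apply: runs_read; rewrite // upd_reg. Qed.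

Lemma runs_read_item rg v pr i w o a k x :
  eval (lay rg v pr) a = k -> x < 2 ^ X ->
  runs X (Read (item_at a)) (St rg v pr (x :: i) w o) (St rg (set_nth 0 v k x) pr i w o) 1.
Proof. by move=> ka lx; apply: runs_read; rewrite // -(upd_v _ _ _ k) -ka. Qed.

Lemma runs_flip_reg rg v pr i (b : bool) w o c : c < 16 ->
  runs X (Flip (Const c)) (St rg v pr i (b :: w) o) (St (set_nth 0 rg c b) v pr i w o) 1.
Proof. by move=> c16; apply: runs_flip; rewrite // upd_reg. Qed.

(* The value of [rg k] at the counter [c] is irrelevant for [0 < k]. *)
Lemma runs_for (rg v pr i : nat -> seq nat) w o c N body m u :
  c < 16 -> m < 2 ^ X ->
  (forall k, k <= m -> eval (lay (set_nth 0 (rg k) c k) (v k) (pr k)) N = m) ->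
  (forall k, k < m ->
     runs X body (St (set_nth 0 (rg k) c k) (v k) (pr k) (i k) (w k) (o k))
       (St (set_nth 0 (rg k.+1) c k) (v k.+1) (pr k.+1) (i k.+1) (w k.+1) (o k.+1)) u) ->
  runs X (For c N body) (St (rg 0) (v 0) (pr 0) (i 0) (w 0) (o 0))
    (St (set_nth 0 (rg m) c m) (v m) (pr m) (i m) (w m) (o m)) (m * u.+2).+2.
Proof.
move=> c16 mX hN hb; rewrite -add1n.
eapply runs_seq; first by apply: (runs_set (x := 0)); rewrite ?expn_gt0.
pose S k := St (set_nth 0 (rg k) c k) (v k) (pr k) (i k) (w k) (o k).
have hc k : eval (Defs.mem (S k)) (reg c) = k by rewrite eval_reg // nth_set_nth /= eqxx.
rewrite -[St _ _ _ _ _ _]/(S 0) -[St (set_nth 0 (rg m) c m) _ _ _ _ _]/(S m).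
apply: runs_while => // [k lk||k lk].
- rewrite -[eval _ _]/(eval _ N - eval _ (reg c)) hN ?(hc k) ?subn_eq0 -?ltnNge //;
  exact: ltnW.
- by rewrite -[eval _ _]/(eval _ N - eval _ (reg c)) hN // (hc m) // subnn.
rewrite -[u.+1]addn1; apply: (runs_seq (hb k lk)).
rewrite /S -[set_nth 0 (rg k.+1) c k.+1](_ : set_nth 0 (set_nth 0 (rg k.+1) c k) c k.+1 = _).
  apply: runs_set => //; last exact: leq_ltn_trans mX.
  by rewrite /= /lay c16 nth_set_nth /= eqxx.
by rewrite set_set_nth eqxx.
Qed.

End Rules.

(* Registers: 0 holds n; 1, 8, 9 are loop counters; 2 holds V, 3 holds 2^(n+1),
   4 holds G, 5 holds beta, 6 holds 2^G.  In the brute-force branch 7 is the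
   shifted mask, 8 the subset sum and 10 the number of hits.  In the other
   branch 7 holds N, 9 a running factorial, 10 the number of primes found,
   11 the number s of factors, 12 the number of coins, 13 the range of a field,
   14 the last coin and then the modulus P, P 2, P 4, ..., and 15 the number
   read from the coins, shifted. *)
Definition init_prog : cmd :=
  (Read (Const 0) ;;
   3 <~ Const 1 ;;
   For 1 (Add (Const 1) (reg 0))
     (Read (item_at (reg 1)) ;;
      2 <~ Add (reg 2) (Deref (item_at (reg 1))) ;;
      3 <~ Mul (Const 2) (reg 3)))%C.

Lemma nth_le_sumn (s : seq nat) i : nth 0 s i <= sumn s.
Proof.
elim: s i => [|x s ih] [|i] //=; first exact: leq_addr.
by apply: leq_trans (ih i) _; rewrite leq_addl.
Qed.

Lemma sumn_take_le (s : seq nat) i : sumn (take i s) <= sumn s.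
Proof. by rewrite -{2}(cat_take_drop i s) sumn_cat leq_addr. Qed.

Section Phases.

Variables (I : instance) (X : nat) (X_gt0 : 0 < X).
Local Notation n := (nelem I).
Local Notation V := (sum_items I).

Local Notation t := (target I).
Local Notation G := (2 ^ beta I).
Local Notation E := (2 ^ n.+1).

Hypothesis n_lt : n.+4 < X.
Hypothesis G_lt : G < X.

Lemma lt_small k : k <= X -> k < 2 ^ X.
Proof. by move=> kX; apply: leq_ltn_trans kX _; apply: ltn_expl. Qed.

Let n_small : n.+4 < 2 ^ X.
Proof. by rewrite lt_small // ltnW. Qed.

Let V_small : V < 2 ^ X.
Proof. by apply: (leq_trans (sum_items_lt I)); rewrite leq_exp2l // ltnW. Qed.

Let E_small : E < 2 ^ X.
Proof. by rewrite ltn_exp2l //; lia. Qed.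

Lemma init_lay w : init I w = St (nseq 16 0) [::] [::] (encode I) w [::].
Proof.
rewrite /init /St; congr State; apply: functional_extensionality => a.
by rewrite /lay; case: ifP => _; [rewrite nth_nseq if_same | case: ifP; rewrite nth_nil].
Qed.

Lemma size_items : size (items I) = n.+1.
Proof. by []. Qed.

Lemma init_runs w :
  runs X init_prog (init I w)
    (St [:: n; n.+1; V; 2 ^ n.+1; 0; 0; 0; 0; 0; 0; 0; 0; 0; 0; 0; 0]
        (items I) [::] [::] w [::])
    (n.+1 * 5 + 4).
Proof.
rewrite init_lay /init_prog.
have -> : St [:: n; n.+1; V; 2 ^ n.+1; 0; 0; 0; 0; 0; 0; 0; 0; 0; 0; 0; 0]
    (items I) [::] [::] w [::] =
  St [:: n; n.+1; sumn (take n.+1 (items I)); 2 ^ n.+1; 0; 0; 0; 0; 0; 0; 0; 0; 0; 0; 0; 0]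
    (take n.+1 (items I)) [::] (drop n.+1 (items I)) w [::].
  by rewrite -size_items take_size drop_size.
eapply runs_weaken; last first.
  eapply runs_seq; first by apply: runs_read_reg => //; lia.
  eapply runs_seq; first by eapply (runs_set X_gt0 (x := 1)) => //; lia.
  eapply (runs_for X_gt0 (c := 1)
    (rg := fun k => [:: n; 0; sumn (take k (items I)); 2 ^ k; 0; 0; 0; 0; 0; 0; 0; 0; 0; 0; 0; 0])
    (v := fun k => take k (items I)) (pr := fun=> [::]) (i := fun k => drop k (items I))
    (w := fun=> w) (o := fun=> [::]) (m := n.+1)) => // [|k lk]; first by lia.
  have lk' : k < size (items I) := lk.
  rewrite (drop_nth 0 lk') (take_nth 0 lk').
  have szt : size (take k (items I)) = k by rewrite size_takel // (ltnW lk').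
  have xV : nth 0 (items I) k < 2 ^ X by apply: leq_ltn_trans (nth_le_sumn _ _) V_small.
  eapply runs_seq.
    by eapply (runs_read_item X_gt0 (k := k)).
  rewrite (set_nth_rcons _ szt).
  eapply runs_seq.
    apply: (runs_set X_gt0 (x := sumn (take k (items I)) + nth 0 (items I) k)) => //.
      by ev; rewrite nth_rcons szt ltnn eqxx.
    rewrite -sumn_rcons -take_nth //; exact: leq_ltn_trans (sumn_take_le _ _) V_small.
  rewrite sumn_rcons.
  apply: (runs_set X_gt0 (x := 2 ^ k.+1)) => //; first by ev; rewrite expnS.
  by apply: leq_ltn_trans E_small; rewrite leq_exp2l // ltnW.
by rewrite /=; lia.
Qed.

(** Squaring [2 ^ G] doubles [G] and increments [beta], so the double logarithm is found without
    computing any logarithm: the loop stops at the first [2 ^ G] above [V], starting from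
    [beta = 1]. *)
Definition doubling_prog : cmd :=
  (4 <~ Const 2 ;; 5 <~ Const 1 ;; 6 <~ Const 4 ;;
   While (Monus (Add (Const 1) (reg 2)) (reg 6))
     (6 <~ Mul (reg 6) (reg 6) ;;
      4 <~ Mul (Const 2) (reg 4) ;;
      5 <~ Add (Const 1) (reg 5)))%C.

Lemma doubling_runs v w :
  runs X doubling_prog
    (St [:: n; n.+1; V; E; 0; 0; 0; 0; 0; 0; 0; 0; 0; 0; 0; 0] v [::] [::] w [::])
    (St [:: n; n.+1; V; E; G; beta I; 2 ^ G; 0; 0; 0; 0; 0; 0; 0; 0; 0] v [::] [::] w [::])
    (beta I * 4 + 4).
Proof.
pose S k := St [:: n; n.+1; V; E; 2 ^ k.+1; k.+1; 2 ^ (2 ^ k.+1); 0; 0; 0; 0; 0; 0; 0; 0; 0]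
  v [::] [::] w [::].
eapply runs_weaken; last first.
  eapply runs_seq; first by apply: (runs_set X_gt0 (x := 2)) => //; lia.
  eapply runs_seq; first by apply: (runs_set X_gt0 (x := 1)) => //; lia.
  eapply runs_seq; first by apply: (runs_set X_gt0 (x := 4)) => //; lia.
  apply: (runs_while X_gt0 (S := S) (N := trunc_log 2 (trunc_log 2 V))) => [k lk||k lk].
  - ev; rewrite -lt0n subn_gt0 add1n ltnS.
    have V0 : 0 < trunc_log 2 V by rewrite lt0n; apply: contraTneq lk => ->; rewrite trunc_log0.
    have VV : 0 < V by rewrite lt0n; apply: contraTneq V0 => ->; rewrite trunc_log0.
    apply: (leq_trans _ (trunc_logP (isT : 1 < 2) VV)); rewrite // leq_exp2l //.
    by apply: (leq_trans _ (trunc_logP (isT : 1 < 2) V0)); rewrite // leq_exp2l.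
  - by ev; apply/eqP; rewrite subn_eq0; apply: sum_items_lt.
  have kb : k.+2 <= beta I by [].
  have kG : 2 ^ k.+2 <= G by rewrite leq_exp2l.
  eapply runs_seq.
    apply: (runs_set X_gt0 (x := 2 ^ (2 ^ k.+2))) => //.
      by ev; rewrite -expnD addnn -mul2n -expnS.
    by rewrite ltn_exp2l // (leq_ltn_trans kG).
  eapply runs_seq.
    apply: (runs_set X_gt0 (x := 2 ^ k.+2)) => //.
    by rewrite lt_small // (leq_trans kG) // ltnW.
  apply: (runs_set X_gt0 (x := k.+2)) => //.
  rewrite lt_small // (leq_trans kb) // ltnW // (leq_trans _ G_lt) // ltnS.
  by rewrite ltnW // ltn_expl.
by rewrite /beta; lia.
Qed.

Fixpoint subset_sum (m i : nat) : nat :=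
  if i is k.+1 then subset_sum m k + nth 0 (weights I) k * (m %/ 2 ^ k %% 2) else 0.

Lemma iter_divn d m k : iter k (divn^~ d) m = m %/ d ^ k.
Proof. by elim: k => [|k ih]; rewrite ?divn1 // iterS ih -divnMA expnSr. Qed.

(** The truncated differences encode the equality test as 0 or 1. The program lets the masks run up
    to [2 ^ (n + 1)], the value it has at hand, so every subset is met twice; only the positivity of
    the count matters. *)
Fixpoint hits (e : nat) : nat :=
  if e is m.+1
  then hits m + (1 - ((subset_sum m n - t) + (t - subset_sum m n))) else 0.

Definition brute_prog : cmd :=
  (For 1 (reg 3)
     (7 <~ reg 1 ;;
      For 9 (reg 0)
        (8 <~ Add (reg 8) (Mul (Deref (weight_at (reg 9))) (Mod (reg 7) (Const 2))) ;;
         7 <~ Div (reg 7) (Const 2)) ;;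
      10 <~ Add (reg 10) (Monus (Const 1)
              (Add (Monus (reg 8) (Deref (Const 16))) (Monus (Deref (Const 16)) (reg 8)))) ;;
      (* The sum in register 8 must restart from 0 for the next mask; clearing 7 and 9 as well makes
         the state at the loop head a simple function of the counter. *)
      7 <~ Const 0 ;; 8 <~ Const 0 ;; 9 <~ Const 0) ;;
   Write (Const 1) ;;
   Write (reg 0) ;;
   Write (Mul (Monus (Const 1) (reg 10)) (Add (Const 1) (reg 0))) ;;
   For 1 (reg 0) (Write (Const 1)))%C.

(* With unit weights, target 0 has exactly one solution and target n+1 none. *)
Definition brute_instance : instance := Instance (nseq n 1) ((1 - hits E) * n.+1).

Lemma subset_sumE m i :
  subset_sum m i = \sum_(k < i) nth 0 (weights I) k * (m %/ 2 ^ k %% 2).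
Proof. by elim: i => [|i ih] /=; rewrite ?big_ord0 // big_ord_recr /= ih. Qed.

Lemma subset_sum_le m i : i <= n -> subset_sum m i <= V.
Proof.
move=> lei; rewrite subset_sumE /sum_items /= sumn_nth.
rewrite (big_ord_widen n (fun k => nth 0 (weights I) k * (m %/ 2 ^ k %% 2)) lei).
rewrite big_mkcond (leq_trans _ (leq_addl _ _)) //; apply: leq_sum => k _.
case: ifP => // _; rewrite -[leqRHS]muln1 leq_mul2l.
by rewrite -ltnS ltn_mod orbT.
Qed.

Lemma hits_le e : hits e <= e.
Proof. by elim: e => //= m ih; rewrite -[m.+1]addn1 leq_add // leq_subr. Qed.

Lemma brute_runs w : E <= G ->
  exists s, runs X brute_prog
    (St [:: n; n.+1; V; E; G; beta I; 2 ^ G; 0; 0; 0; 0; 0; 0; 0; 0; 0]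
      (items I) [::] [::] w [::]) s
    (E * (n * 4 + 10) + n * 3 + 20) /\ out s = encode_list [:: brute_instance].
Proof.
move=> EG; eexists; split.
eapply runs_weaken; last first.
  eapply runs_seq.
    eapply (runs_for X_gt0 (c := 1)
      (rg := fun k => [:: n; n.+1; V; E; G; beta I; 2 ^ G; 0; 0; 0; hits k; 0; 0; 0; 0; 0])
      (v := fun=> items I) (pr := fun=> [::]) (i := fun=> [::])
      (w := fun=> w) (o := fun=> [::]) (m := E)) => // m lm.
    eapply runs_seq.
      by apply: (runs_set X_gt0 (x := m)) => //; apply: ltn_trans lm E_small.
    eapply runs_seq.
      eapply (runs_for X_gt0 (c := 9)
        (rg := fun k => [:: n; m; V; E; G; beta I; 2 ^ G; iter k (divn^~ 2) m; subset_sum m k; 0;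
           hits m; 0; 0; 0; 0; 0])
        (v := fun=> items I) (pr := fun=> [::]) (i := fun=> [::])
        (w := fun=> w) (o := fun=> [::]) (m := n)) => // [|k lk]; first by lia.
      eapply runs_seq.
        apply: (runs_set X_gt0 (x := subset_sum m k.+1)) => //.
          by ev; rewrite iter_divn {1}(divn_eq (m %/ 2 ^ k) 2) addKn.
        by apply: leq_ltn_trans V_small; apply: subset_sum_le.
      apply: (runs_set X_gt0 (x := iter k.+1 (divn^~ 2) m)) => //.
      rewrite iter_divn; apply: leq_ltn_trans (leq_div _ _) _.
      exact: ltn_trans lm E_small.
    eapply runs_seq.
      apply: (runs_set X_gt0 (x := hits m.+1)) => //.
      by rewrite lt_small // (leq_trans (hits_le _)) // (leq_trans lm) // (leq_trans EG) // ltnW.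
    eapply runs_seq; first by apply: (runs_set X_gt0 (x := 0)) => //; rewrite expn_gt0.
    eapply runs_seq; first by apply: (runs_set X_gt0 (x := 0)) => //; rewrite expn_gt0.
    by apply: (runs_set X_gt0 (x := 0)) => //; rewrite expn_gt0.
  eapply runs_seq; first by eapply (runs_write X_gt0 (x := 1)).
  eapply runs_seq; first by eapply (runs_write X_gt0 (x := n)).
  eapply runs_seq; first by eapply (runs_write X_gt0 (x := (1 - hits E) * n.+1)).
  eapply (runs_for X_gt0 (c := 1)
    (rg := fun k => [:: n; E; V; E; G; beta I; 2 ^ G; 0; 0; 0; hits E; 0; 0; 0; 0; 0])
    (v := fun=> items I) (pr := fun=> [::]) (i := fun=> [::])
    (w := fun=> w) (o := fun k => [:: 1; n; (1 - hits E) * n.+1] ++ nseq k 1)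
    (m := n)) => // [|k lk]; first by lia.
  have -> : [:: 1; n; (1 - hits E) * n.+1] ++ nseq k.+1 1 =
    rcons ([:: 1; n; (1 - hits E) * n.+1] ++ nseq k 1) 1.
    by rewrite rcons_cat; congr cat; elim: (k) => //= ? <-.
  by apply: (runs_write X_gt0).
- by rewrite /=; lia.
by rewrite /encode_list /= /encode /nelem /= size_nseq cats0.
Qed.

End Phases.

(* Wilson's criterion: register 9 holds the factorial of [q - 1] when [q] is tested. *)
Definition table_step : cmd :=
  If (Mod (Add (Const 1) (reg 9)) (Add (Const 2) (reg 1)))
    Skip
    (Store (prime_at (reg 10)) (Add (Const 2) (reg 1)) ;;
     10 <~ Add (Const 1) (reg 10))%C.

Definition table_prog : cmd :=
  (7 <~ Mul (Const 2) (Mul (reg 4) (reg 4)) ;;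
   9 <~ Const 1 ;;
   For 1 (Monus (Mul (reg 7) (reg 7)) (Const 2))
     (table_step ;;
      9 <~ Mul (reg 9) (Add (Const 2) (reg 1))) ;;
   9 <~ Const 0)%C.

Definition params_prog : cmd :=
  (11 <~ Add (Const 1) (Div (Add (Mul (Const 2) (reg 0)) (Const 4))
                           (Add (Const 1) (reg 5))) ;;
   12 <~ Mul (Add (Add (Const 1) (Mul (Const 2) (reg 5))) (Add (Const 1) (reg 0)))
             (Add (reg 11) (Add (Const 1) (reg 0))) ;;
   13 <~ Mul (reg 3) (reg 7))%C.

Definition flip_prog : cmd :=
  For 1 (reg 12)
    (Flip (Const 14) ;;
     15 <~ Add (Mul (Const 2) (reg 15)) (reg 14) ;;
     14 <~ Const 0)%C.

Definition modulus_prog : cmd :=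
  (14 <~ Const 1 ;;
   For 1 (reg 11)
     (14 <~ Mul (reg 14) (Deref (prime_at (Mod (reg 15) (reg 7)))) ;;
      15 <~ Div (reg 15) (reg 13)))%C.

Definition hashing_prog : cmd :=
  For 1 (Add (Const 1) (reg 0))
    (Store (item_at (reg 1))
       (Add (Mod (Deref (item_at (reg 1))) (reg 14))
            (Mul (reg 14) (Mod (reg 15) (reg 13)))) ;;
     15 <~ Div (reg 15) (reg 13))%C.

Definition output_prog : cmd :=
  (Write (Mul (Add (Const 3) (reg 0)) (reg 0)) ;;
   For 1 (Add (Const 3) (reg 0))
     (For 8 (reg 0)
        (Write (reg 0) ;;
         Write (Add (Mod (Deref (Const 16)) (reg 14)) (Mul (reg 8) (reg 14))) ;;
         For 9 (reg 0) (Write (Mod (Deref (weight_at (reg 9))) (reg 14))) ;;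
         9 <~ Const 0) ;;
      8 <~ Const 0 ;;
      14 <~ Mul (Const 2) (reg 14)))%C.

(** Output of a loop after [k] rounds, defined by recursion so that the effect of one more round
    holds by computation. *)
Fixpoint cat_upto (o : seq nat) (f : nat -> seq nat) (k : nat) : seq nat :=
  if k is k'.+1 then cat_upto o f k' ++ f k' else o.

Lemma cat_uptoE o f k : cat_upto o f k = o ++ flatten (mkseq f k).
Proof.
elim: k => [|k ih]; first by rewrite cats0.
by rewrite [LHS]/= ih mkseqS flatten_rcons catA.
Qed.

Lemma subn_divn_mul a b : a - a %/ b * b = a %% b.
Proof. by rewrite {1}(divn_eq a b) addKn. Qed.

Lemma set_nth_cat (p : seq nat) x q y :
  set_nth 0 (p ++ x :: q) (size p) y = p ++ y :: q.
Proof. by elim: p => //= z p ->. Qed.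

Lemma flatten_map_flatten (A B : Type) (f : A -> seq B) (ss : seq (seq A)) :
  flatten (map f (flatten ss)) = flatten (map (fun l => flatten (map f l)) ss).
Proof. by elim: ss => //= l ss ih; rewrite map_cat flatten_cat ih. Qed.

Lemma iter_muln d P k : iter k (muln d) P = P * d ^ k.
Proof. by elim: k => [|k ih]; rewrite ?muln1 // iterS ih expnS mulnCA. Qed.

Lemma fact_le_expn m : m`! <= m ^ m.
Proof.
elim: m => // m ih; rewrite factS expnS leq_mul2l /=.
by apply: leq_trans ih _; case: m => // m; rewrite leq_exp2r.
Qed.

Section Phases.

Variables (I : instance) (X : nat) (X_gt0 : 0 < X).
Local Notation n := (nelem I).
Local Notation V := (sum_items I).
Local Notation G := (2 ^ beta I).
Local Notation E := (2 ^ n.+1).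
Local Notation N := (tab_size I).
Local Notation s := (nfactors I).
Local Notation H := (2 ^ field_width I).
Local Notation T := (field_width I * nfields I).

Hypothesis n_lt : n.+4 < X.
Hypothesis G_lt : G < X.
Hypothesis N_lt : N * N * (N * N) < X.
Hypothesis T_lt : T < X.
Hypothesis P_le : 2 * tab_log I * s + field_width I + n + 4 <= X.

Definition small_primes k := [seq p <- iota 2 k | prime p].

Lemma small_primesS k : small_primes k.+1 =
  if prime k.+2 then rcons (small_primes k) k.+2 else small_primes k.
Proof.
rewrite /small_primes -[in LHS](addn1 k) iotaD filter_cat /= add2n; case: ifP => _.
  by rewrite cats1.
by rewrite cats0.
Qed.

Lemma size_small_primes k : size (small_primes k) <= k.
Proof. by rewrite size_filter (leq_trans (count_size _ _)) // size_iota. Qed.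

Lemma small_primes_table : small_primes (N * N - 2) = prime_table I.
Proof. by rewrite /prime_table /primes_below mul2n -addnn expnD. Qed.

Let N_gt1 : 1 < N.
Proof. by rewrite /tab_size /tab_log (leq_exp2l 1). Qed.

Let NN_lt : N * N < X.
Proof. by apply: leq_ltn_trans N_lt; rewrite leq_pmulr // muln_gt0; lia. Qed.

Lemma table_step_runs k r2 r3 r4 r5 r6 r7 v w : k.+2 < 2 ^ X ->
  runs X table_step
    (St [:: n; k; r2; r3; r4; r5; r6; r7; 0; k.+1`!; size (small_primes k); 0; 0; 0; 0; 0]
       v (small_primes k) [::] w [::])
    (St [:: n; k; r2; r3; r4; r5; r6; r7; 0; k.+1`!; size (small_primes k.+1); 0; 0; 0; 0; 0]
       v (small_primes k.+1) [::] w [::]) 3.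
Proof.
move=> lX; have test M : eval (lay [:: n; k; r2; r3; r4; r5; r6; r7; 0; k.+1`!; M; 0; 0; 0; 0; 0]
    v (small_primes k)) (Mod (Add (Const 1) (reg 9)) (Add (Const 2) (reg 1))) =
    (k.+1`!).+1 %% k.+2 by rewrite eval_Mod; ev.
rewrite small_primesS; case: ifP => pk.
  apply: (runs_if_false X_gt0).
    by rewrite test; apply/eqP; rewrite -/(dvdn _ _) -Wilson.
  apply: (runs_seq (u1 := 1) (u2 := 1)).
    by apply: (runs_set_prime X_gt0 (k := size (small_primes k)) (x := k.+2)).
  rewrite (set_nth_rcons _ (erefl _)) size_rcons; apply: (runs_set X_gt0) => //.
  by apply: (leq_ltn_trans _ lX); have := size_small_primes k; lia.
apply: (@runs_weaken _ _ _ _ 2) => //; apply: (runs_if_true X_gt0); last exact: runs_skip.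
by rewrite test -/(dvdn _ _) -Wilson ?pk.
Qed.

Lemma table_runs v w :
  runs X table_prog
    (St [:: n; n.+1; V; E; G; beta I; 2 ^ G; 0; 0; 0; 0; 0; 0; 0; 0; 0] v [::] [::] w [::])
    (St [:: n; N * N - 2; V; E; G; beta I; 2 ^ G; N; 0; 0; size (prime_table I); 0; 0; 0; 0; 0]
       v (prime_table I) [::] w [::])
    (N * N * 6 + 6).
Proof.
rewrite -small_primes_table.
eapply runs_weaken; last first.
  eapply runs_seq.
    apply: (runs_set X_gt0 (x := N)) => //; first by ev; rewrite tab_sizeE.
    by apply: lt_small; rewrite // ltnW // (leq_ltn_trans _ NN_lt) // leq_pmulr //; lia.
  eapply runs_seq; first by apply: (runs_set X_gt0 (x := 1)) => //; apply: lt_small.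
  eapply runs_seq.
    eapply (runs_for X_gt0 (c := 1)
      (rg := fun k => [:: n; n.+1; V; E; G; beta I; 2 ^ G; N; 0; k.+1`!;
                          size (small_primes k); 0; 0; 0; 0; 0])
      (v := fun=> v) (pr := small_primes) (i := fun=> [::])
      (w := fun=> w) (o := fun=> [::]) (m := N * N - 2)) => // [|k lk].
      apply: lt_small; rewrite // ; lia.
    have lX : k.+2 < 2 ^ X by apply: lt_small => //; lia.
    eapply runs_seq.
      by apply: table_step_runs.
    apply: (runs_set X_gt0 (x := k.+2`!)) => //.
      by ev; rewrite mulnC -factS.
    (* With [q = k + 2] at most [N ^ 2], the factorial of [q] is at most [q ^ q], hence at most
       [2 ^ (q ^ 2)]. This is why registers need more than [N ^ 4] bits. *)
    apply: leq_ltn_trans (fact_le_expn _) _.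
    have l1 : k.+2 ^ k.+2 <= (2 ^ k.+2) ^ k.+2 by rewrite leq_exp2r // ltnW // ltn_expl.
    apply: leq_ltn_trans l1 _; rewrite -expnM ltn_exp2l //.
    by apply: leq_ltn_trans N_lt; apply: leq_mul; lia.
  by apply: (runs_set X_gt0 (x := 0)) => //; apply: lt_small.
by move: N_gt1; lia.
Qed.

Lemma params_runs v pr c10 w :
  runs X params_prog
    (St [:: n; N * N - 2; V; E; G; beta I; 2 ^ G; N; 0; 0; c10; 0; 0; 0; 0; 0]
       v pr [::] w [::])
    (St [:: n; N * N - 2; V; E; G; beta I; 2 ^ G; N; 0; 0; c10; s; T; H; 0; 0]
       v pr [::] w [::]) 3.
Proof.
have sX : s <= X.
  apply: leq_trans P_le; rewrite -!addnA (leq_trans _ (leq_addr _ _)) //.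
  by rewrite leq_pmull // muln_gt0 /tab_log.
apply: (runs_seq (u1 := 1) (u2 := 2)).
  by apply: (runs_set X_gt0 (x := s)) => //; apply: lt_small.
apply: (runs_seq (u1 := 1) (u2 := 1)).
  by apply: (runs_set X_gt0 (x := T)) => //; apply: lt_small; rewrite // ltnW.
apply: (runs_set X_gt0 (x := H)) => //; first by ev; rewrite field_rangeE.
by rewrite ltn_exp2l //; lia.
Qed.

Variable r : seq bool.
Hypothesis r_size : T <= size r.

Local Notation R := (bits_val (take T r)).

Lemma flip_runs v pr c10 :
  runs X flip_prog
    (St [:: n; N * N - 2; V; E; G; beta I; 2 ^ G; N; 0; 0; c10; s; T; H; 0; 0]
       v pr [::] r [::])
    (St [:: n; T; V; E; G; beta I; 2 ^ G; N; 0; 0; c10; s; T; H; 0; R]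
       v pr [::] (drop T r) [::]) (T * 5 + 2).
Proof.
eapply runs_weaken; last first.
  have e : St [:: n; N * N - 2; V; E; G; beta I; 2 ^ G; N; 0; 0; c10; s; T; H; 0; 0]
       v pr [::] r [::] =
    St [:: n; N * N - 2; V; E; G; beta I; 2 ^ G; N; 0; 0; c10; s; T; H; 0;
       bits_val (take 0 r)] v pr [::] (drop 0 r) [::] by rewrite take0 drop0.
  rewrite e.
  eapply (runs_for X_gt0 (c := 1)
      (rg := fun k => [:: n; N * N - 2; V; E; G; beta I; 2 ^ G; N; 0; 0; c10; s; T; H; 0;
                       bits_val (take k r)])
      (v := fun=> v) (pr := fun=> pr) (i := fun=> [::])
      (w := fun k => drop k r) (o := fun=> [::]) (m := T)) => // [|k lk].
    by apply: lt_small => //; exact: ltnW.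
  have lk' := leq_trans lk r_size.
  rewrite (drop_nth false lk').
  eapply runs_seq; first by apply: runs_flip_reg.
  eapply runs_seq.
    apply: (runs_set X_gt0 (x := bits_val (take k.+1 r))) => //.
      by ev; rewrite (take_nth false lk') bits_val_rcons.
    apply: leq_trans (bits_val_lt _) _; rewrite leq_exp2l // size_takel //.
    by rewrite (leq_trans lk) // ltnW.
  by apply: (runs_set X_gt0 (x := 0)) => //; apply: lt_small.
by lia.
Qed.

Fixpoint partial_modulus (k : nat) : nat :=
  if k is k'.+1
  then partial_modulus k' * nth 0 (prime_table I) (iter k' (divn^~ H) R %% N) else 1.

Lemma partial_modulusE : partial_modulus s = modulus I (field H R).
Proof.
rewrite /modulus; elim: (s) => [|k ih] /=; first by rewrite big_ord0.
(* The program reduces modulo [N] directly, skipping the reduction modulo the field range; the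
   result is the same because [N] divides that range. *)
rewrite big_ord_recr /= ih iter_divn /field modn_dvdm //.
by rewrite field_rangeE dvdn_mull.
Qed.

Lemma partial_modulus_le k : partial_modulus k <= 2 ^ (2 * tab_log I * k).
Proof.
elim: k => [|k ih] /=; first by rewrite muln0.
rewrite mulnS addnC expnD leq_mul //.
by have /andP[_ /ltnW] := nth_prime_table (ltn_pmod (iter k (divn^~ H) R) (tab_size_gt0 I)).
Qed.

Let R_small k : iter k (divn^~ H) R < 2 ^ X.
Proof.
rewrite iter_divn; apply: leq_ltn_trans (leq_div _ _) _.
apply: leq_trans (bits_val_lt _) _; rewrite leq_exp2l // size_takel //.
exact: ltnW.
Qed.

Lemma modulus_runs v c10 w :
  runs X modulus_prog
    (St [:: n; T; V; E; G; beta I; 2 ^ G; N; 0; 0; c10; s; T; H; 0; R]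
       v (prime_table I) [::] w [::])
    (St [:: n; s; V; E; G; beta I; 2 ^ G; N; 0; 0; c10; s; T; H;
            modulus I (field H R); iter s (divn^~ H) R]
       v (prime_table I) [::] w [::]) (s * 4 + 3).
Proof.
rewrite -partial_modulusE; eapply runs_weaken; last first.
  eapply runs_seq; first by apply: (runs_set X_gt0 (x := 1)) => //; apply: lt_small.
  eapply (runs_for X_gt0 (c := 1)
      (rg := fun k => [:: n; T; V; E; G; beta I; 2 ^ G; N; 0; 0; c10; s; T; H;
                       partial_modulus k; iter k (divn^~ H) R])
      (v := fun=> v) (pr := fun=> prime_table I) (i := fun=> [::])
      (w := fun=> w) (o := fun=> [::]) (m := s)) => // [|k lk].
    apply: lt_small => //; apply: leq_trans P_le.
    rewrite -!addnA (leq_trans _ (leq_addr _ _)) //.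
    by rewrite leq_pmull // muln_gt0 /tab_log.
  eapply runs_seq.
    apply: (runs_set X_gt0 (x := partial_modulus k.+1)) => //.
      by ev; rewrite subn_divn_mul.
    apply: leq_ltn_trans (partial_modulus_le _) _; rewrite ltn_exp2l //.
    have := leq_mul (leqnn (2 * tab_log I)) lk; move: P_le.
    by move: (_ * s) (_ * k.+1) => a b; lia.
  by apply: (runs_set X_gt0 (x := iter k.+1 (divn^~ H) R)).
by lia.
Qed.

Let P := modulus I (field H R).
Let h := hashed I (field H R).

Let hE i : h i = nth 0 (items I) i %% P +
   P * (iter i (divn^~ H) (iter s (divn^~ H) R) %% H).
Proof. by rewrite /h /hashed -iterD iter_divn (addnC s i). Qed.

Lemma hashed_le i : h i <= P * H.+1.
Proof.
rewrite hE mulnS; apply: leq_add; first by rewrite ltnW // ltn_mod modulus_gt0.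
by rewrite leq_mul2l ltnW ?orbT // ltn_mod expn_gt0.
Qed.

Let P_ub : P <= 2 ^ (2 * tab_log I * s).
Proof. exact: modulus_ub. Qed.

Lemma hashing_runs pr c10 w :
  runs X hashing_prog
    (St [:: n; s; V; E; G; beta I; 2 ^ G; N; 0; 0; c10; s; T; H; P; iter s (divn^~ H) R]
       (items I) pr [::] w [::])
    (St [:: n; n.+1; V; E; G; beta I; 2 ^ G; N; 0; 0; c10; s; T; H;
            P; iter n.+1 (divn^~ H) (iter s (divn^~ H) R)]
       (mkseq h n.+1) pr [::] w [::]) (n * 4 + 10).
Proof.
eapply runs_weaken; last first.
  (* Hashing is done in place: at round [k] the array is a hashed prefix of length [k] followed by
     the untouched items. *)
  have -> : mkseq h n.+1 = mkseq h n.+1 ++ drop n.+1 (items I).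
    by rewrite -[X in drop X _]size_items drop_size cats0.
  eapply (runs_for X_gt0 (c := 1)
      (rg := fun k => [:: n; s; V; E; G; beta I; 2 ^ G; N; 0; 0; c10; s; T; H;
                       P; iter k (divn^~ H) (iter s (divn^~ H) R)])
      (v := fun k => mkseq h k ++ drop k (items I)) (pr := fun=> pr) (i := fun=> [::])
      (w := fun=> w) (o := fun=> [::]) (m := n.+1)) => // [|k lk].
    by apply: lt_small => //; lia.
  have lk' : k < size (items I) := lk.
  have nthk : nth 0 (mkseq h k ++ drop k (items I)) k = nth 0 (items I) k.
    by rewrite nth_cat size_mkseq ltnn subnn nth_drop addn0.
  have -> : mkseq h k.+1 ++ drop k.+1 (items I) =
      set_nth 0 (mkseq h k ++ drop k (items I)) k (h k).
    rewrite (drop_nth 0 lk') mkseqS -cats1 -catA.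
    by have := set_nth_cat (mkseq h k) (nth 0 (items I) k) (drop k.+1 (items I)) (h k);
      rewrite size_mkseq => ->.
  eapply runs_seq.
    apply: (runs_set_item X_gt0 (k := k) (x := h k)) => //.
      by ev; rewrite !subn_divn_mul nthk hE.
    apply: leq_ltn_trans (hashed_le k) _.
    apply: (@leq_ltn_trans (2 ^ (2 * tab_log I * s) * 2 ^ (field_width I).+1)).
      apply: leq_mul => //; rewrite expnS mul2n -addnn -addn1 leq_add2l expn_gt0 //.
    by rewrite -expnD ltn_exp2l //; lia.
  apply: (runs_set X_gt0 (x := iter k.+1 (divn^~ H) (iter s (divn^~ H) R))) => //.
  by rewrite -iterD.
by lia.
Qed.

Lemma output_runs pr r15 c10 w u10 :
  runs X output_prog
    (St [:: n; n.+1; V; E; G; beta I; u10; N; 0; 0; c10; s; T; H; P; r15]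
       (mkseq h n.+1) pr [::] w [::])
    (St [:: n; n + 3; V; E; G; beta I; u10; N; 0; 0; c10; s; T; H;
            iter (n + 3) (muln 2) P; r15]
       (mkseq h n.+1) pr [::] w (encode_list (hash_instances I (field H R))))
    ((n + 3) * (n * (n * 3 + 10) + 10) + 10).
Proof.
have Q_small j : j <= n + 3 -> iter j (muln 2) P < 2 ^ X.
  move=> lj; rewrite iter_muln; apply: (@leq_ltn_trans (2 ^ (2 * tab_log I * s) * 2 ^ (n + 3))).
    by rewrite leq_mul // leq_exp2l.
  by rewrite -expnD ltn_exp2l //; lia.
pose enc j k := encode (hash_instance I (field H R) j k).
pose encs j := flatten (mkseq (enc j) n).
have oE : encode_list (hash_instances I (field H R)) = cat_upto [:: (3 + n) * n] encs (n + 3).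
  rewrite cat_uptoE /encode_list size_hash_instances [in LHS](addnC n 3); congr (_ :: _).
  rewrite /hash_instances flatten_map_flatten -map_comp; congr flatten.
  by apply: eq_map => j /=; rewrite /encs /mkseq -map_comp.
eapply runs_weaken; last first.
  eapply runs_seq.
    by apply: (runs_write X_gt0 (x := (3 + n) * n)); ev.
  rewrite oE; eapply (runs_for X_gt0 (c := 1)
      (rg := fun j => [:: n; n.+1; V; E; G; beta I; u10; N; 0; 0; c10; s; T; H;
                          iter j (muln 2) P; r15])
      (v := fun=> mkseq h n.+1) (pr := fun=> pr) (i := fun=> [::])
      (w := fun=> w) (o := fun j => cat_upto [:: (3 + n) * n] encs j)
      (m := n + 3)) => // [|j _|j lj].
  - by apply: lt_small => //; lia.
  - by rewrite addnC.
  set Q := iter j (muln 2) P; set o := cat_upto _ _ j.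
  have QE : Q = P * 2 ^ j by rewrite /Q iter_muln.
  have -> : cat_upto [:: (3 + n) * n] encs j.+1 = cat_upto o (enc j) n.
    by rewrite [RHS]cat_uptoE.
  eapply runs_seq.
    eapply (runs_for X_gt0 (c := 8)
      (rg := fun k => [:: n; j; V; E; G; beta I; u10; N; 0; 0; c10; s; T; H; Q; r15])
      (v := fun=> mkseq h n.+1) (pr := fun=> pr) (i := fun=> [::])
      (w := fun=> w) (o := fun k => cat_upto o (enc j) k)
      (m := n)) => // [|k lk]; first by apply: lt_small => //; lia.
    set o' := cat_upto _ _ k.
    pose a := h 0 %% Q + k * Q.
    have -> : cat_upto o (enc j) k.+1 =
        cat_upto (rcons (rcons o' n) a) (fun i => [:: h i.+1 %% Q]) n.
      rewrite [RHS]cat_uptoE [LHS]/= -/o' -!cats1 -!catA; congr cat.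
      rewrite /enc /encode /nelem size_hash_weights /= -QE; congr [:: _, _ & _].
      rewrite /mkseq flatten_map1 -(addn0 1) iotaDl -map_comp.
      by apply: eq_map => i /=; rewrite add1n.
    eapply runs_seq; first by apply: (runs_write X_gt0 (x := n)).
    eapply runs_seq.
      apply: (runs_write X_gt0 (x := a)).
      by ev; rewrite subn_divn_mul.
    eapply runs_seq.
      eapply (runs_for X_gt0 (c := 9)
        (rg := fun i => [:: n; j; V; E; G; beta I; u10; N; k; 0; c10; s; T; H; Q; r15])
        (v := fun=> mkseq h n.+1) (pr := fun=> pr) (i := fun=> [::])
        (w := fun=> w)
        (o := fun i => cat_upto (rcons (rcons o' n) a) (fun i => [:: h i.+1 %% Q]) i)
        (m := n)) => // [|i li]; first by apply: lt_small => //; lia.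
      rewrite [cat_upto _ _ i.+1]/= cats1; apply: (runs_write X_gt0).
      by ev; rewrite subn_divn_mul (nth_map 0) ?size_iota // nth_iota.
    by apply: (runs_set X_gt0 (x := 0)) => //; apply: lt_small.
  eapply runs_seq; first by apply: (runs_set X_gt0 (x := 0)) => //; apply: lt_small.
  by apply: (runs_set X_gt0 (x := iter j.+1 (muln 2) P)) => //; apply: Q_small; lia.
by lia.
Qed.

End Phases.

(** * The assembled program *)

Definition brute_case (I : instance) : bool := 2 ^ (nelem I).+1 <= 2 ^ beta I.

Definition ncoins (I : instance) : nat := field_width I * nfields I.

Definition reduce (I : instance) (r : seq bool) : seq instance :=
  if brute_case I then [:: brute_instance I]
  else hash_instances I (field (2 ^ field_width I) (bits_val (take (ncoins I) r))).

Definition main_prog : cmd :=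
  (init_prog ;;
   doubling_prog ;;
   If (Monus (Add (Const 1) (reg 4)) (reg 3))
     brute_prog
     (table_prog ;; params_prog ;; flip_prog ;; modulus_prog ;; hashing_prog ;; output_prog))%C.

(** The sum of all quantities that the phases require to be bounded by the register length; a sum,
    unlike a maximum, is polynomially bounded by the closure lemmas at once. *)
Definition reg_bits (I : instance) : nat :=
  (nelem I + 5) + (2 ^ beta I).+1 +
  (tab_size I * tab_size I * (tab_size I * tab_size I)).+1 + (ncoins I).+1 +
  (2 * tab_log I * nfactors I + field_width I + nelem I + 4).

Definition nsteps (I : instance) : nat :=
  ((nelem I).+1 * 5 + 4) + (beta I * 4 + 4) +
  (2 ^ beta I * (nelem I * 4 + 10) + nelem I * 3 + 20 +
   (tab_size I * tab_size I * 6 + 6) + 3 + (ncoins I * 5 + 2) +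
   (nfactors I * 4 + 3) + (nelem I * 4 + 10) +
   ((nelem I + 3) * (nelem I * (nelem I * 3 + 10) + 10) + 10)).+1.

Lemma main_prog_runs I r : ncoins I <= size r ->
  exists s k, [/\ exec main_prog (init I r) s k, out s = encode_list (reduce I r)
    & k <= nsteps I * (reg_bits I * cweight main_prog)].
Proof.
move=> lr; set X := reg_bits I.
have h1 : (nelem I).+4 < X by rewrite /X /reg_bits; lia.
have h2 : 2 ^ beta I < X by rewrite /X /reg_bits; lia.
have h3 : tab_size I * tab_size I * (tab_size I * tab_size I) < X by rewrite /X /reg_bits; lia.
have h4 : field_width I * nfields I < X by rewrite /X /reg_bits -/(ncoins I); lia.
have h5 : 2 * tab_log I * nfactors I + field_width I + nelem I + 4 <= X.
  by rewrite /X /reg_bits leq_addl.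
have X0 : 0 < X by apply: leq_ltn_trans h1.
suff [s [hs os]] : exists s, runs X main_prog (init I r) s (nsteps I) /\
    out s = encode_list (reduce I r).
  have [|[k ek kl] _] := hs; first by move=> a; rewrite expn_gt0.
  by exists s, k.
have i1 := @init_runs I X X0 h1 h2 r; have i2 := @doubling_runs I X X0 h1 h2 (items I) r.
rewrite /reduce; case: ifP => br.
  have [s [hs os]] := brute_runs X0 h1 h2 r br; exists s; split=> //.
  have e : Defs.eval (lay [:: nelem I; (nelem I).+1; sum_items I; 2 ^ (nelem I).+1; 2 ^ beta I; beta I;
       2 ^ 2 ^ beta I; 0; 0; 0; 0; 0; 0; 0; 0; 0] (items I) [::])
      (Monus (Add (Const 1) (reg 4)) (reg 3)) != 0.
    by ev; rewrite subn_eq0 -ltnNge add1n ltnS.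
  eapply runs_weaken; last first.
    eapply runs_seq; first exact: i1.
    eapply runs_seq; first exact: i2.
    by eapply (runs_if_true X0); [exact: e | exact: hs].
  rewrite /nsteps; move: br; rewrite /brute_case => br.
  have := leq_mul br (leqnn (nelem I * 4 + 10)).
  by move: (_ * _ + 10) => a; lia.
have e : Defs.eval (lay [:: nelem I; (nelem I).+1; sum_items I; 2 ^ (nelem I).+1; 2 ^ beta I; beta I;
       2 ^ 2 ^ beta I; 0; 0; 0; 0; 0; 0; 0; 0; 0] (items I) [::])
      (Monus (Add (Const 1) (reg 4)) (reg 3)) = 0.
  by ev; apply/eqP; rewrite subn_eq0 add1n ltnNge; move: br; rewrite /brute_case => ->.
pose tab := prime_table I; pose sz := size tab; pose rest := drop (ncoins I) r.
have t1 := @table_runs I X X0 h1 h2 h3 h4 h5 (items I) r.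
have t2 := @params_runs I X X0 h1 h2 h3 h4 h5 (items I) tab sz r.
have t3 := @flip_runs I X X0 h1 h2 h3 h4 h5 r lr (items I) tab sz.
have t4 := @modulus_runs I X X0 h1 h2 h3 h4 h5 r lr (items I) sz rest.
have t5 := @hashing_runs I X X0 h1 h2 h3 h4 h5 r lr tab sz rest.
have t6 := @output_runs I X X0 h1 h2 h3 h4 h5 r lr.
eexists; split; last first.
  instantiate (1 := St _ _ _ _ _ _); reflexivity.
eapply runs_weaken; last first.
  eapply runs_seq; first exact: i1.
  eapply runs_seq; first exact: i2.
  eapply (runs_if_false X0); first exact: e.
  eapply runs_seq; first exact: t1.
  eapply runs_seq; first exact: t2.
  eapply runs_seq; first exact: t3.
  eapply runs_seq; first exact: t4.
  eapply runs_seq; first exact: t5.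
  exact: t6.
rewrite /nsteps -/(ncoins I).
move: (ncoins I * 5) (tab_size I * _ * _) (nfactors I * 4) (2 ^ beta I * _) => *.
by move: ((nelem I + 3) * _) => *; lia.
Qed.

(** * Polynomial bounds *)

Definition poly_bounded (f : instance -> nat) : Prop :=
  exists c d, forall I, f I <= c * isize I ^ d.

Lemma isize_gt0 I : 0 < isize I.
Proof. by rewrite /isize /encode big_cons /blen. Qed.

Lemma poly_bounded_const c : poly_bounded (fun=> c).
Proof. by exists c, 0 => I; rewrite muln1. Qed.

Lemma poly_bounded_le f g : (forall I, f I <= g I) -> poly_bounded g -> poly_bounded f.
Proof. by move=> fg [c [d h]]; exists c, d => I; apply: leq_trans (fg I) (h I). Qed.

Lemma poly_bounded_add f g : poly_bounded f -> poly_bounded g ->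
  poly_bounded (fun I => f I + g I).
Proof.
move=> [c [d h]] [c' [d' h']]; exists (c + c'), (d + d') => I.
rewrite mulnDl; apply: leq_add.
  by apply: leq_trans (h I) _; rewrite leq_mul2l leq_pexp2l ?orbT ?isize_gt0 ?leq_addr.
by apply: leq_trans (h' I) _; rewrite leq_mul2l leq_pexp2l ?orbT ?isize_gt0 ?leq_addl.
Qed.

Lemma poly_bounded_mul f g : poly_bounded f -> poly_bounded g ->
  poly_bounded (fun I => f I * g I).
Proof.
move=> [c [d h]] [c' [d' h']]; exists (c * c'), (d + d') => I.
by rewrite expnD mulnACA leq_mul.
Qed.

Lemma poly_bounded_succ f : poly_bounded f -> poly_bounded (fun I => (f I).+1).
Proof.
move=> h; apply: poly_bounded_le (poly_bounded_add h (poly_bounded_const 1)) => I.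
by rewrite addn1.
Qed.

Lemma poly_bounded_nelem : poly_bounded nelem.
Proof.
exists 1, 1 => I; rewrite mul1n expn1 /isize /encode 2!big_cons /nelem.
rewrite addnA (leq_trans _ (leq_addl _ _)) //.
elim: (weights I) => //= k l ih; rewrite big_cons -add1n leq_add //.
Qed.

Lemma sumn_lt (l : seq nat) : sumn l < 2 ^ (\sum_(k <- l) blen k).
Proof.
elim: l => [|k l ih]; first by rewrite big_nil.
rewrite /= big_cons expnD; have : k < 2 ^ blen k by apply: trunc_log_ltn.
move: ih (2 ^ blen k); set a := 2 ^ _ => ih b kb.
by move: ih; case: a => // a; rewrite ltnS => ih; nia.
Qed.

(** The reason the table is affordable: [G / 2] is at most the logarithm of [V], and [V] has no more
    bits than its summands have together. *)
Lemma beta_le I : 2 ^ beta I <= 2 * isize I.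
Proof.
rewrite /beta expnS leq_mul2l /=.
case: (posnP (trunc_log 2 (sum_items I))) => [->|lg0].
  by rewrite trunc_log0 isize_gt0.
apply: leq_trans (trunc_logP (isT : 1 < 2) lg0) _.
have V0 : 0 < sum_items I by rewrite lt0n; apply: contraTneq lg0 => ->; rewrite trunc_log0.
rewrite -(@leq_exp2l 2) // (leq_trans (trunc_logP (isT : 1 < 2) V0)) // ltnW //.
apply: leq_trans (sumn_lt _) _; rewrite leq_exp2l // /isize /encode [leqRHS]big_cons.
exact: leq_addl.
Qed.

(** [ncoins] is added so that one polynomial bounds the running time and also supplies enough
    coins. *)
Lemma poly_bounded_cost c :
  poly_bounded (fun I => nsteps I * (reg_bits I * c) + ncoins I).
Proof.
have A := poly_bounded_add; have M := poly_bounded_mul; have C := poly_bounded_const.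
have S := poly_bounded_succ; have n := poly_bounded_nelem.
have G : poly_bounded (fun I => 2 ^ beta I).
  by exists 2, 1 => I; rewrite expn1 beta_le.
have b : poly_bounded beta.
  by apply: poly_bounded_le G => I; rewrite ltnW // ltn_expl.
have tl : poly_bounded tab_log by apply: S; apply: M.
have N : poly_bounded tab_size.
  by apply: poly_bounded_le (M _ _ (C 2) (M _ _ G G)) => I; rewrite tab_sizeE.
have s : poly_bounded nfactors.
  apply: poly_bounded_le (S _ (A _ _ (M _ _ (C 2) n) (C 4))) => I.
  by rewrite ltnS leq_div.
have fw : poly_bounded field_width by apply: A => //; apply: S.
have nf : poly_bounded nfields by apply: A => //; apply: S.
have nc : poly_bounded ncoins by apply: M.
rewrite /nsteps /reg_bits.
repeat lazymatch goal with
  | |- poly_bounded (fun I => @?f I + @?g I) => apply: (A f g)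
  | |- poly_bounded (fun I => @?f I * @?g I) => apply: (M f g)
  | |- poly_bounded (fun I => (@?f I).+1) => apply: (S f)
  | |- _ => first [exact: C | assumption]
  end.
Qed.

Lemma horner_monomial (c d z : nat) :
  ((c%:P * 'X^d : {poly nat}).[z])%R = c * z ^ d.
Proof. by rewrite hornerM hornerC hornerXn natrXE. Qed.

(** * Correctness of the exhaustive search *)

Lemma exists_digits n (b : nat -> bool) :
  exists2 m, m < 2 ^ n & forall k, k < n -> m %/ 2 ^ k %% 2 = b k.
Proof.
elim: n b => [|n ih] b; first by exists 0.
have [m lm h] := ih (fun k => b k.+1); exists (b 0 + 2 * m).
  by rewrite expnS; case: (b 0); lia.
have e : (b 0 + 2 * m) %/ 2 = m by rewrite addnC mulnC divnMDl // divn_small ?addn0 //; case: (b 0).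
move=> [|k] lk; last by rewrite expnS divnMA e h.
by rewrite divn1 addnC mulnC modnMDl modn_small //; case: (b 0).
Qed.

Lemma hits_gt0 I e : reflect (exists2 m, m < e & subset_sum I m (nelem I) = target I) (0 < hits I e).
Proof.
elim: e => [|e ih] /=; first by constructor; case.
set a := subset_sum I e _.
have d : (0 < 1 - ((a - target I) + (target I - a))) = (a == target I) by lia.
rewrite addn_gt0 d; apply: (iffP orP) => [[/ih[m lm h]|/eqP h]|[m lm h]].
- by exists m => //; apply: ltnW.
- by exists e.
move: lm; rewrite ltnS leq_eqVlt => /orP[/eqP e1|lm]; last by left; apply/ih; exists m.
by right; rewrite /a -e1 h.
Qed.

Lemma hits_solvable I : (0 < hits I (2 ^ (nelem I).+1)) = solvable I.
Proof.
rewrite solvableE; apply/hits_gt0/set0Pn => [[m _ h]|[x]].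
  exists [tuple m %/ 2 ^ i %% 2 == 1 | i < nelem I]; rewrite inE -h subset_sumE.
  apply/eqP; apply: eq_bigr => i _; rewrite tnth_mktuple; congr (_ * _).
  by have := ltn_pmod (m %/ 2 ^ i) (isT : 0 < 2); case: (_ %% _) => [|[|]].
rewrite inE => /eqP h; have [m lm hm] := exists_digits (nelem I) (nth false x).
exists m; first by rewrite expnS; lia.
rewrite subset_sumE -h; apply: eq_bigr => i _; rewrite hm //.
by rewrite (tnth_nth false).
Qed.

Lemma dot_ones n (x : n.-tuple bool) : dot (nseq n 1) x = \sum_(i < n) tnth x i.
Proof. by apply: eq_bigr => i _; rewrite nth_nseq ltn_ord mul1n. Qed.

Lemma brute_unsolvable I : ~~ solvable I -> ~~ solvable (brute_instance I).
Proof.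
rewrite -hits_solvable -eqn0Ngt => /eqP h0; apply/negP.
move=> /(solvableP _ (size_nseq (nelem I) 1)) [x].
rewrite dot_ones /= h0 mul1n => e; have : \sum_(i < nelem I) tnth x i <= nelem I.
  by rewrite -[leqRHS]card_ord -sum1_card; apply: leq_sum => i _; apply: leq_b1.
by rewrite e ltnn.
Qed.

Lemma brute_isolated I : solvable I -> nsol (brute_instance I) = 1.
Proof.
rewrite -hits_solvable => h0; rewrite (nsolE _ (size_nseq (nelem I) 1)).
have -> : 1 - hits I (2 ^ (nelem I).+1) = 0 by lia.
rewrite (_ : [set x | _] = [set [tuple of nseq (nelem I) false]]) ?cards1 //.
apply/setP => x; rewrite !inE dot_ones mul0n sum_nat_eq0; apply/forallP/eqP => [h|-> i].
  apply: eq_from_tnth => i; have := h i; rewrite [RHS](tnth_nth false) nth_nseq ltn_ord.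
  by rewrite eqb0 => /negPf.
by rewrite (tnth_nth false) nth_nseq ltn_ord.
Qed.

(** * Probability of success *)

Lemma hash_instances_eq I f f' : (forall i, i < nfields I -> f i = f' i) ->
  hash_instances I f = hash_instances I f'.
Proof.
move=> e; have eP : modulus I f = modulus I f'.
  by apply: modulus_eq => i li; apply: e; rewrite /nfields ltn_addr.
have eh i : i <= nelem I -> hashed I f i = hashed I f' i.
  by move=> li; rewrite /hashed eP e // /nfields ltn_add2l.
rewrite /hash_instances; congr flatten; apply: eq_map => j; apply: eq_map => k.
rewrite /hash_instance eP eh //; congr Instance; apply/eq_in_map => i.
by rewrite mem_iota => /andP[_ li]; rewrite eh // -ltnS.
Qed.

Lemma prob_true m (E : pred (seq bool)) : (forall r, E r) -> prob m E = 1%R.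
Proof.
move=> ET; rewrite /prob (_ : [set r | _] = setT); last by apply/setP => r; rewrite !inE ET.
by rewrite cardsT card_tuple card_bool natrX divff // expf_neq0.
Qed.

Lemma prob_hash I m (a : seq instance -> bool) : ncoins I <= m ->
  prob m (fun r => a (hash_instances I
     (field (2 ^ field_width I) (bits_val (take (ncoins I) r))))) =
  (#|[set w : {ffun 'I_(nfields I) -> 'I_(2 ^ field_width I)} |
        a (hash_instances I (natf w))]|%:R /
   #|{: {ffun 'I_(nfields I) -> 'I_(2 ^ field_width I)}}|%:R)%R.
Proof.
move=> le; rewrite card_Omega -(@prob_fields _ _ m (fun f => a (hash_instances I f))) //.
by move=> f f' e; rewrite (hash_instances_eq e).
Qed.

Lemma target_hash_le I f j k : 0 < nelem I -> ~~ brute_case I ->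
  j < nelem I + 3 -> k < nelem I ->
  target (hash_instance I f j k) <= 2 ^ (40 * nelem I).
Proof.
rewrite /brute_case -ltnNge ltn_exp2l // ltnS => n0 bn lj lk /=.
set n := nelem I in n0 bn lj lk *; set Q := _ * 2 ^ j.
have Q0 : 0 < Q by rewrite muln_gt0 modulus_gt0 expn_gt0.
have tQ : hashed I f 0 %% Q + k * Q <= n * Q.
  by rewrite (leq_trans _ (leq_mul lk (leqnn Q))) // mulSn leq_add2r ltnW // ltn_mod.
apply: (leq_trans tQ).
(* Outside the brute-force case [beta <= n], so [P] has at most [4 (3n + 5)] bits. The factor
   [2 ^ j] adds less than [n + 3] and the carry at most [n]; the total [14 n + 23] is below [40 n]
   for positive [n]. *)
have ts : 2 * tab_log I * nfactors I <= 12 * n + 20.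
  apply: (@leq_trans (4 * ((beta I).+1 * nfactors I))).
    by rewrite mulnA leq_mul2r /tab_log; apply/orP; right; lia.
  by have := nfactors_ub I; rewrite -/n; lia.
have QP : Q <= 2 ^ (12 * n + 20) * 2 ^ (n + 3).
  rewrite leq_mul ?leq_exp2l //; last exact: ltnW.
  by apply: leq_trans (modulus_ub I f) _; rewrite leq_exp2l.
apply: leq_trans (leq_mul (ltnW (ltn_expl n (isT : 1 < 2))) QP) _.
by rewrite -!expnD leq_exp2l //; lia.
Qed.

Lemma reduce_shape I r :
  [/\ 0 < nelem I -> size (reduce I r) <= 4 * nelem I ^ 3,
      all (fun J => nelem J == nelem I) (reduce I r)
    & 0 < nelem I -> all (fun J => target J <= 2 ^ (40 * nelem I)) (reduce I r)].
Proof.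
rewrite /reduce; case: (boolP (brute_case I)) => br; split.
- by move=> n0; rewrite /= muln_gt0 expn_gt0 n0.
- by rewrite /= /nelem size_nseq eqxx.
- move=> n0; rewrite /= andbT.
  apply: (@leq_trans (nelem I).+1); first by rewrite -[leqRHS]mul1n leq_mul2r leq_subr orbT.
  by apply: leq_trans (ltn_expl _ (isT : 1 < 2)) _; rewrite leq_exp2l // leq_pmull.
- move=> n0; rewrite size_hash_instances; move: n0; case: (nelem I) => // n _.
  by rewrite !expnS expn0; nia.
- by apply: all_hash_instances => j k _ _; rewrite /nelem size_hash_weights.
- by move=> n0; apply: all_hash_instances => j k lj lk; apply: target_hash_le.
Qed.

Lemma reduce_unsolvable I m : ncoins I <= m -> ~~ solvable I ->
  (1 - 2%:R^-1 ^+ (nelem I + 4) <=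
    prob m (fun r => all (fun J => ~~ solvable J) (reduce I r)))%R.
Proof.
move=> le ns; rewrite /reduce; case: (boolP (brute_case I)) => _.
  rewrite prob_true => [|r]; last by rewrite /= brute_unsolvable.
  by rewrite gerBl exprn_ge0 // invr_ge0 ler0n.
rewrite (@prob_hash I m (all (fun J => ~~ solvable J))) //.
have := card_spurious I.
set Om := #|{: {ffun 'I_(nfields I) -> 'I_(2 ^ field_width I)}}|.
set A := #|_|; set B := #|_| => hA.
have O0 : (0 < Om%:R :> rat)%R by rewrite ltr0n /Om card_Omega expn_gt0.
have AB : Om <= A + B.
  apply: leq_trans (leq_card_setU _ _); rewrite /Om -cardsT.
  apply: subset_leq_card; apply/subsetP => w _; rewrite in_setU.
  case: (boolP (spurious I (natf w))) => sp.
    by apply/orP; left; rewrite inE.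
  by apply/orP; right; rewrite inE hash_instances_unsolvable.
rewrite ler_pdivlMr // mulrBl mul1r lerBlDr.
apply: (@le_trans _ _ (A%:R + B%:R)%R); first by rewrite -natrD ler_nat.
rewrite addrC lerD2l exprVn mulrC ler_pdivlMr ?exprn_gt0 //.
by rewrite -natrX -natrM ler_nat.
Qed.

Lemma reduce_isolates I m : ncoins I <= m -> solvable I ->
  (16%:R^-1 <= prob m (fun r => has (fun J => (0 < nsol J <= 1)%N) (reduce I r)))%R.
Proof.
move=> le so; rewrite /reduce; case: (boolP (brute_case I)) => br.
  rewrite prob_true => [|r]; last by rewrite /= brute_isolated.
  by rewrite invf_le1.
(* With no elements the hashed output would be empty, but since [beta] is at least 1 that input
   falls into the brute-force case. *)
have n0 : 0 < nelem I.
  rewrite lt0n; apply: contra br => /eqP e.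
  by rewrite /brute_case e leq_exp2l.
rewrite (@prob_hash I m (has (fun J => (0 < nsol J <= 1)%N))) //.
have := card_good n0 so.
set Om := #|{: {ffun 'I_(nfields I) -> 'I_(2 ^ field_width I)}}|; set B := #|_| => h.
have O0 : (0 < Om%:R :> rat)%R by rewrite ltr0n /Om card_Omega expn_gt0.
by rewrite ler_pdivlMr // mulrC ler_pdivrMr // mulrC -natrM ler_nat.
Qed.

Theorem theorem3 :
  exists (p : {poly nat}) (A : instance -> seq bool -> seq instance),
  rand_polytime p A /\
  (exists K L : nat, forall (I : instance) (r : seq bool),
     size r = (p.[isize I])%R ->
     [/\ 0 < nelem I -> size (A I r) <= K * nelem I ^ 3,
         all (fun J => nelem J == nelem I) (A I r)
       & 0 < nelem I -> all (fun J => target J <= 2 ^ (L * nelem I)) (A I r)]) /\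
  (forall delta : rat, (0 < delta)%R ->
     exists n0 : nat, forall I : instance, n0 <= nelem I -> ~~ solvable I ->
       (1 - delta <=
          prob (p.[isize I])%R (fun r => all (fun J => ~~ solvable J) (A I r)))%R) /\
  (exists (D : nat) (gamma : rat), (0 < gamma)%R /\
     forall I : instance, solvable I ->
       (gamma <=
          prob (p.[isize I])%R (fun r => has (fun J => (0 < nsol J <= D)%N) (A I r)))%R).
Proof.
have [c [d cost]] := poly_bounded_cost (cweight main_prog).
pose p : {poly nat} := (c%:P * 'X^d)%R.
have coins_le I : ncoins I <= (p.[isize I])%R.
  by rewrite horner_monomial; apply: leq_trans (cost I); rewrite leq_addl.
exists p, reduce; split; [|split; [|split]].
- exists main_prog => I r rp.
  have [|s [k [ex os kl]]] := @main_prog_runs I r; first by rewrite rp coins_le.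
  exists s, k; split=> //; rewrite horner_monomial; apply: leq_trans kl _.
  by apply: leq_trans (cost I); rewrite leq_addr.
- by exists 4, 40 => I r _; apply: reduce_shape.
(* The failure probability is at most [2 ^ -(n + 4)], and [2 ^ n] exceeds [n], so it suffices that
   [n] be at least the inverse of [delta]. *)
- move=> delta d0; exists (Num.bound delta^-1) => I le ns.
  apply: le_trans (reduce_unsolvable (coins_le I) ns); rewrite lerD2l lerN2 exprVn.
  rewrite -[leRHS]invrK lef_pV2 ?posrE ?invr_gt0 ?exprn_gt0 //.
  have := archi_boundP (ltW (_ : 0 < delta^-1)%R); rewrite invr_gt0 => /(_ d0) /ltW h.
  apply: le_trans h _; rewrite -natrX ler_nat; apply: leq_trans le _.
  by apply: leq_trans (ltnW (ltn_expl _ (isT : 1 < 2))) _; rewrite leq_exp2l // leq_addr.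
exists 1, (16%:R^-1)%R; split=> [|I so]; first by rewrite invr_gt0.
exact: reduce_isolates.
Qed.
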